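(* Let $n\ge 1$, let $\mathbb{V}=\mathbb{C}^{n+1}$ with a Hermitian form $\langle\cdot,\cdot\rangle$ of signature $(n,1)$, and let $U(n,1)$ be its unitary group, acting on complex hyperbolic space $H^n_{\mathbb{C}}$. (1) Let $T\in U(n,1)$ act as an elliptic isometry of $H^n_{\mathbb{C}}$. Then an element $S\in U(n,1)$ commutes with $T$ if and only if $S$ preserves each eigenspace of $T$. (2) Let $T\in U(n,1)$ act as a hyperbolic isometry of $H^n_{\mathbb{C}}$. Then an element $S\in U(n,1)$ commutes with $T$ if and only if $S$ preserves each eigenspace of $T$ and $S$ acts either as the identity or as a strictly hyperbolic isometry on the complex line joining the two fixed points of $T$. (3) Let $T\in U(n,1)$ be a translation with fixed point $x\in\partial H^n_{\mathbb{C}}$, and let $S\in U(n,1)$ commute with $T$. Then one of the following holds: (i) $S$ is a boundary elliptic with $S(x)=x$ and $T(\mathrm{fix}(S))=\mathrm{fix}(S)$; (ii) $S$ is a translation with $S(x)=x$, and $S$ and $T$ are isotropic; (iii) $S$ is an ellipto-parabolic with fixed point $x$, and its Jordan decomposition $S=S_sS_u$ satisfies $T(\mathrm{fix}(S_s))=\mathrm{fix}(S_s)$ and $T$ and $S_u$ are isotropic. (4) Let $T=T_sT_u\in U(n,1)$ be an ellipto-parabolic with fixed point $x\in\partial H^n_{\mathbb{C}}$ (Jordan decomposition $T=T_sT_u$), and let $S\in U(n,1)$ commute with $T$. Then one of the following holds: (i) $S$ is a boundary elliptic with $S(x)=x$, $T_u(\mathrm{fix}(S))=\mathrm{fix}(S)$,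 and $T_s$ preserves each eigenspace of $S$; (ii) $S$ is a translation with $S(x)=x$, $S(\mathrm{fix}(T_s))=\mathrm{fix}(T_s)$, and $S$ and $T_u$ are isotropic; (iii) $S$ is an ellipto-parabolic with fixed point $x$, and its Jordan decomposition $S=S_sS_u$ satisfies $T_u(\mathrm{fix}(S_s))=\mathrm{fix}(S_s)$, $S_u(\mathrm{fix}(T_s))=\mathrm{fix}(T_s)$, $T_u$ and $S_u$ are isotropic, and $T_s$ preserves each eigenspace of $S_s$.
   Context: Let $\mathbb{V}_-=\{z:\langle z,z\rangle<0\}$, $\mathbb{V}_0=\{z\ne0:\langle z,z\rangle=0\}$, and $\pi:\mathbb{V}\setminus\{0\}\to P(\mathbb{V})$ the projectivization. Complex hyperbolic space is $H^n_{\mathbb{C}}=\pi(\mathbb{V}_-)$, with boundary $\partial H^n_{\mathbb{C}}=\pi(\mathbb{V}_0)$; $U(n,1)$ acts on $\overline{H^n_{\mathbb{C}}}=H^n_{\mathbb{C}}\cup\partial H^n_{\mathbb{C}}$ by isometries (via $PU(n,1)$). For $g\in U(n,1)$, $\mathrm{fix}(g)$ is the set of points of $\overline{H^n_{\mathbb{C}}}$ fixed by $g$ (these correspond to eigenvectors of $g$ in $\mathbb{V}_-\cup\mathbb{V}_0$). An element is elliptic if it fixes a point of $H^n_{\mathbb{C}}$; parabolic, resp. hyperbolic, if it is not elliptic and has exactly one, resp. exactly two, fixed points on $\partial H^n_{\mathbb{C}}$. An eigenvalue of $g$ is negative if it has an eigenvector in $\mathbb{V}_-$; an elliptic $g$ is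 a boundary elliptic if its negative eigenvalue has multiplicity at least $2$. A hyperbolic element is strictly hyperbolic if all its eigenvalues are real. For hyperbolic $T$, the complex line joining its fixed points is the projective image (intersected with $\overline{H^n_{\mathbb{C}}}$) of the 2-dimensional subspace spanned by its two null eigenvectors; it is a copy of $H^1_{\mathbb{C}}$. A parabolic element is a translation if it is unipotent (all eigenvalues $1$), and an ellipto-parabolic otherwise; a parabolic $g$ has a Jordan decomposition $g=g_sg_u=g_ug_s$ with $g_s\in U(n,1)$ semisimple and $g_u\in U(n,1)$ unipotent. Heisenberg translations: in the Siegel model (Hermitian form $\langle z,w\rangle=w^*Jz$ with $J=\begin{pmatrix}0&0&1\\0&I_{n-1}&0\\1&0&0\end{pmatrix}$, point $\infty=\pi((1,0,\dots,0)^t)$), for $(\tau,t)\in\mathbb{C}^{n-1}\times\mathbb{R}$ let $T_{(\tau,t)}=\begin{pmatrix}1&-\tau^*&\frac{-|\tau|^2+ti}{2}\\0&I_{n-1}&\tau\\0&0&1\end{pmatrix}$. Two unipotent parabolic elements $S,T$ with a common fixed point $x\in\partial H^n_{\mathbb{C}}$ are called isotropic if, for $K\in U(n,1)$ with $K(x)=\infty$ (conjugating both into Siegel form), $KTK^{-1}=T_{(\tau,t)}$ and $KSK^{-1}=T_{(\sigma,s)}$ with $\mathrm{Im}(\tau^*\sigma)=0$ (this is independent of the choice of $K$). *)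

(* Defs.v *)
From HB Require Import structures.
From mathcomp Require Import all_boot all_order all_algebra.
From mathcomp Require Import complex.
From mathcomp Require Import reals.
Set Implicit Arguments.
Unset Strict Implicit.
Unset Printing Implicit Defensive.
Import Order.TTheory GRing.Theory Num.Theory.
Local Open Scope ring_scope.
Local Open Scope sesquilinear_scope.

Section CHyp.
Variable C : numClosedFieldType.

Section Forms.
Variable m : nat.
Implicit Types (J g h A : 'M[C]_m) (z w : 'cV[C]_m).

Definition hform J z w : C := (w ^t* *m J *m z) 0 0.

Definition stdsig : 'M[C]_m.+1 :=
  diag_mx (\row_(i < m.+1) (if i == ord_max then -1 else 1)).

Definition isU J g : Prop := g ^t* *m J *m g = J.

Definition negv J z : Prop := hform J z z < 0.
Definition nullv J z : Prop := z != 0 /\ hform J z z = 0.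
(* z represents a point of the closure of complex hyperbolic space *)
Definition in_closure J z : Prop := z != 0 /\ hform J z z <= 0.

(* g fixes the projective point [z] (z is an eigenvector of g) *)
Definition fixes g z : Prop := exists l : C, g *m z = l *: z.
(* [z] = [w] as projective points (for nonzero z) *)
Definition proportional z w : Prop := exists c : C, w = c *: z.

Definition elliptic J g : Prop := exists z, negv J z /\ fixes g z.

Definition parabolic J g : Prop :=
  ~ elliptic J g /\
  exists x, [/\ nullv J x, fixes g x &
    (forall y, nullv J y -> fixes g y -> proportional x y)].

Definition hyperbolic J g : Prop :=
  ~ elliptic J g /\
  exists x y, [/\ nullv J x /\ fixes g x, nullv J y /\ fixes g y,
    ~ proportional x y &
    (forall z, nullv J z -> fixes g z -> proportional x z \/ proportional y z)].

Definition eigenvalue_of g (l : C) : Prop := root (char_poly g) l.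

Definition negative_eigenvalue J g (l : C) : Prop :=
  exists z, negv J z /\ g *m z = l *: z.

Definition boundary_elliptic J g : Prop :=
  elliptic J g /\
  exists l, negative_eigenvalue J g l /\ (2 <= mup l (char_poly g))%N.

Definition strictly_hyperbolic J g : Prop :=
  hyperbolic J g /\ forall l, eigenvalue_of g l -> l \is Num.real.

Definition unipotent g : Prop := forall l, eigenvalue_of g l -> l = 1.

Definition translation J g : Prop := parabolic J g /\ unipotent g.
Definition ellipto_parabolic J g : Prop := parabolic J g /\ ~ unipotent g.

Definition jordan_decomp J g gs gu : Prop :=
  [/\ isU J gs /\ isU J gu, diagonalizable gs, unipotent gu,
      g = gs *m gu & gs *m gu = gu *m gs].

(* fix(g) : the points of the closure of H^n_C fixed by g
   (as a scale-invariant set of representing vectors) *)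
Definition fixpts J g : 'cV[C]_m -> Prop :=
  fun z => in_closure J z /\ fixes g z.

Definition preserves A (P : 'cV[C]_m -> Prop) : Prop :=
  (forall z, P z -> P (A *m z)) /\
  (forall z, P z -> exists w, P w /\ A *m w = z).

Definition eigenspace_of g (l : C) : 'cV[C]_m -> Prop :=
  fun v => g *m v = l *: v.

Definition preserves_eigenspaces A g : Prop :=
  forall l, eigenvalue_of g l -> preserves A (eigenspace_of g l).

End Forms.

(* The complex line spanned by z1, z2 is identified with H^1_C for the
   2x2 Gram form G = B^* J B, B = [z1 z2].  S acts on it by the 2x2 matrix M
   with S B = B M.  S acts as the identity on the line iff M is scalar, and
   as a strictly hyperbolic isometry iff some lift c M (|c| = 1) of the
   induced element of PU(1,1) is strictly hyperbolic. *)
Definition line_basis m (z1 z2 : 'cV[C]_m) : 'M[C]_(m, 2) := row_mx z1 z2.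

Definition acts_id_or_strictly_hyperbolic_on_line m (J S : 'M[C]_m) (z1 z2 : 'cV[C]_m) : Prop :=
  let B := line_basis z1 z2 in
  let G : 'M[C]_2 := B ^t* *m J *m B in
  exists M : 'M[C]_2, S *m B = B *m M /\
    (is_scalar_mx M \/
     exists c : C, c * c^* = 1 /\ strictly_hyperbolic G (c *: M)).


Definition hermitian_sig m (J : 'M[C]_m.+1) : Prop :=
  J ^t* = J /\ exists P : 'M[C]_m.+1, P \in unitmx /\ J = P ^t* *m stdsig m *m P.

Section Siegel.
Variable n : nat.

Definition mid (k : 'I_n.+1) : bool := (0 < k < n)%N.

Definition siegelJ : 'M[C]_n.+1 :=
  \matrix_(i, j) (if ((i == ord0) && (j == ord_max)) ||
                    ((i == ord_max) && (j == ord0)) || ((i == j) && mid i)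
                  then 1 else 0).

(* infinity = pi((1,0,...,0)^t) *)
Definition e0 : 'cV[C]_n.+1 := \col_(i < n.+1) (i == ord0)%:R.

(* T_(tau,t); only the middle coordinates tau_1..tau_(n-1) of tau are used *)
Definition heis (tau : 'cV[C]_n.+1) (t : C) : 'M[C]_n.+1 :=
  let nsq := \sum_(k < n.+1 | mid k) tau k 0 * (tau k 0)^* in
  \matrix_(i, j)
    (if i == j then 1
     else if (i == ord0) && mid j then - (tau j 0)^*
     else if (i == ord0) && (j == ord_max) then (- nsq + t * 'i) / 2%:R
     else if mid i && (j == ord_max) then tau i 0
     else 0).

(* S, T (unipotent parabolic with common fixed point x) are isotropic:
   for K : (C^(n+1), J) -> (C^(n+1), J_S) an isometry with K(x) = infinity,
   K T K^-1 = T_(tau,t), K S K^-1 = T_(sigma,s) and Im(tau^* sigma) = 0. *)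
Definition isotropic (J : 'M[C]_n.+1) (x : 'cV[C]_n.+1) (S T : 'M[C]_n.+1) : Prop :=
  exists K : 'M[C]_n.+1,
    [/\ K \in unitmx, K ^t* *m siegelJ *m K = J,
        (exists c : C, c != 0 /\ K *m x = c *: e0) &
        exists tau t sigma s,
          [/\ t \is Num.real, s \is Num.real,
              K *m T *m invmx K = heis tau t,
              K *m S *m invmx K = heis sigma s &
              'Im (\sum_(k < n.+1 | mid k) (tau k 0)^* * sigma k 0) = 0]].
End Siegel.

End CHyp.

(* Main.v *)
(* Every S commuting with T commutes with both Jordan parts of T, since the
   semisimple part is a polynomial in T; by uniqueness of the decomposition both
   parts are again unitary.  A unipotent element of U(n,1) fixing a negative
   vector is trivial, which makes elliptic and hyperbolic elements
   diagonalizable, and for these commuting means preserving eigenspaces.  If T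
   is parabolic with fixed point x, then S fixes x; S cannot be hyperbolic,
   since T would fix its second null eigenline, and if S is elliptic, T moves
   its negative eigenvectors, whose eigenvalue is then multiple.  Finally, two
   commuting unipotents fixing x become Heisenberg translations in a Siegel
   frame at x, where comparing the upper right entries of the two products
   yields Im(tau^* sigma) = 0. *)
Require Import Defs.
From HB Require Import structures.
From mathcomp Require Import all_boot all_order all_algebra.
From mathcomp Require Import complex.
From mathcomp Require Import reals.
From mathcomp Require Import ring.
From mathcomp Require boolp.
Import Order.TTheory GRing.Theory Num.Theory.
Local Open Scope ring_scope.
Local Open Scope sesquilinear_scope.

(** * Jordan decomposition *)

(** Since the form is indefinite, a unitary matrix need not be diagonalizable, and nothing in a
    polynomial expression for the semisimple part shows it to be unitary; the adjoint for the form
    and uniqueness supply this. The signature is exploited through one consequence: the form is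
    positive definite on a hyperplane, so an orthogonal pair of nonpositive vectors is always
    proportional. Hence the form is definite on the complement of a negative vector, while on the
    complement of a null vector x its null vectors are the multiples of x. Both situations are
    handled by one computation: a unipotent isometry U, restricted to a suitable subspace, satisfies
    <(U-1)z, (U-1)z> = 0. On the first complement this makes U - 1 vanish; on the second it sends U
    - 1 into the line of x, which is what forces the Heisenberg shape in the Siegel model. *)

Definition nilpotent_mx {F : fieldType} {n} (A : 'M[F]_n.+1) : Prop :=
  exists k, A ^+ k = 0.

Section Jordan.
Context {F : fieldType} {n : nat}.
Implicit Types A B D N U P : 'M[F]_n.+1.

Lemma nilpotent_mxMl A B : A *m B = B *m A -> nilpotent_mx B ->
  nilpotent_mx (A *m B).
Proof.
move=> cAB [k Bk]; exists k.
by rewrite -[A *m B]/(A * B) exprMn_comm // Bk mulr0.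
Qed.

Lemma nilpotent_mxD A B : A *m B = B *m A -> nilpotent_mx A ->
  nilpotent_mx B -> nilpotent_mx (A + B).
Proof.
move=> cAB [k Ak] [l Bl]; exists (k + l)%N.
rewrite exprDn_comm //; apply: big1 => i _.
have [le_li|lt_il] := leqP l i.
  by rewrite -(subnK le_li) [B ^+ _]exprD Bl !mulr0 mul0rn.
have le_k : (k <= k + l - i)%N by rewrite -addnBA ?leq_addr // ltnW.
by rewrite -(subnK le_k) exprD Ak mulr0 mul0r mul0rn.
Qed.

Lemma nilpotent_mxN A : nilpotent_mx A -> nilpotent_mx (- A).
Proof. by case=> k Ak; exists k; rewrite exprNn Ak mulr0. Qed.

Lemma nilpotent_mx_conj P A : P \in unitmx ->
  nilpotent_mx A -> nilpotent_mx (P *m A *m invmx P).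
Proof.
move=> Pu [k Ak]; exists k.
have /= := @horner_mx_uconj F n 'X^k P A Pu.
by rewrite !rmorphXn /= !horner_mx_X Ak mulmx0 mul0mx.
Qed.

Lemma nilpotent_mx_diag (d : 'rV[F]_n.+1) :
  nilpotent_mx (diag_mx d) -> diag_mx d = 0.
Proof.
case=> k dk.
suff -> : d = 0 by apply/matrixP=> i j; rewrite !mxE mul0rn.
apply/rowP=> i; rewrite mxE.
have := congr1 (fun M : 'M_n.+1 => M i i) dk.
have -> : diag_mx d ^+ k = horner_mx (diag_mx d) 'X^k.
  by rewrite rmorphXn /= horner_mx_X.
rewrite horner_mx_diag !mxE eqxx mulr1n hornerXn => /eqP.
by rewrite expf_eq0 => /andP[_ /eqP].
Qed.

Lemma diagonalizableW A : diagonalizable A ->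
  exists2 P, P \in unitmx & exists d : 'rV[F]_n.+1,
    P *m A *m invmx P = diag_mx d.
Proof.
case=> P Pu /diagonalizable_forPex[d /(simmxRL Pu) dE].
by exists P => //; exists d; rewrite dE.
Qed.

Lemma codiagonalizableW A B : A *m B = B *m A ->
  diagonalizable A -> diagonalizable B ->
  exists2 P, P \in unitmx & exists d e : 'rV[F]_n.+1,
    P *m A *m invmx P = diag_mx d /\ P *m B *m invmx P = diag_mx e.
Proof.
move=> cAB dA dB.
have [|P Pu] := (@codiagonalizableP F n.+1 [:: A; B]).1.
  split=> [X Y|X]; rewrite !inE.
    by move=> /orP[]/eqP-> /orP[]/eqP->; rewrite /comm_mx.
  by move=> /orP[]/eqP->.
rewrite /= andbT => /andP[/diagonalizable_forPex[d /(simmxRL Pu) dE]].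
move=> /diagonalizable_forPex[e /(simmxRL Pu) eE].
by exists P => //; exists d, e; rewrite dE eE.
Qed.

(** This is the uniqueness half of the Jordan decomposition: in a common eigenbasis [A - B] is
    diagonal, and a nilpotent diagonal matrix is zero. *)
Lemma diagonalizable_nilpotent_eq A B : A *m B = B *m A ->
  diagonalizable A -> diagonalizable B -> nilpotent_mx (A - B) -> A = B.
Proof.
move=> cAB dA dB nAB.
have [P Pu [d [e [dE eE]]]] := codiagonalizableW _ _ cAB dA dB.
have E : P *m (A - B) *m invmx P = diag_mx (d - e).
  by rewrite mulmxBr mulmxBl dE eE linearB.
have := nilpotent_mx_conj _ _ Pu nAB; rewrite E => /nilpotent_mx_diag z.
apply/eqP; rewrite -subr_eq0; apply/eqP.
have : invmx P *m (P *m (A - B) *m invmx P) *m P = 0.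
  by rewrite E z mulmx0 mul0mx.
by rewrite !mulmxA mulVmx // mul1mx mulmxKV.
Qed.

Lemma diagonalizableM A B : A *m B = B *m A ->
  diagonalizable A -> diagonalizable B -> diagonalizable (A *m B).
Proof.
move=> cAB dA dB.
have [P Pu [d [e [dE eE]]]] := codiagonalizableW _ _ cAB dA dB.
exists P => //; apply/diagonalizable_forPex.
exists (\row_i (d 0 i * e 0 i)); apply/(simmxRL Pu).
rewrite -mulmx_diag -dE -eE !mulmxA mulmxKV //.
Qed.

(** The geometric series of powers of [1 - A] terminates and inverts [A]. *)
Lemma nilpotent_sub1_unit A : nilpotent_mx (A - 1%:M) -> A \in unitmx.
Proof.
case=> k Nk; have := subrX1 (1 - A) k.
have -> : (1 - A) ^+ k = 0 by rewrite -opprB exprNn (Nk : (A - 1) ^+ k = 0) mulr0.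
rewrite sub0r [1 - A - 1]addrAC subrr sub0r mulNr => /oppr_inj/esym e.
by have [] := mulmx1_unit e.
Qed.

(* The semisimple part of A is a polynomial in A, by the Chinese remainder
   theorem applied to p = r mod ('X - r)^k for every eigenvalue r. *)
Lemma chinese_root_poly (rs : seq F) (k : nat) : uniq rs ->
  exists p : {poly F}, forall r, r \in rs -> ('X - r%:P) ^+ k %| p - r%:P.
Proof.
elim: rs => [|r rs IH] /=; first by exists 0.
case/andP=> rNrs /IH[p pP].
pose M := \prod_(s <- rs) ('X - s%:P) ^+ k.
have cM : coprimep (('X - r%:P) ^+ k) M.
  rewrite /M; elim: rs {IH pP M} rNrs => [|s rs IH].
    by rewrite big_nil coprimep1.
  rewrite inE negb_or => /andP[rs0 /IH c]; rewrite big_cons coprimepMr c andbT.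
  by apply/coprimep_expl/coprimep_expr/coprimep_XsubC2; rewrite subr_eq0 eq_sym.
have [[u v] /= uv] := Bezout_eq1_coprimepP _ _ cM.
(* By Bezout, [v * M] is 1 modulo the power of ['X - r%:P] and 0 modulo the other powers, so the
   correction sets the residue at [r] and keeps the earlier ones. *)
exists (p + v * M * (r%:P - p)) => s; rewrite inE => /predU1P[->|srs].
  have -> : p + v * M * (r%:P - p) - r%:P
      = (u * (p - r%:P)) * ('X - r%:P) ^+ k.
    rewrite (_ : v * M = 1 - u * ('X - r%:P) ^+ k); last first.
      by rewrite -uv addrAC subrr add0r.
    by set W := _ ^+ k; set c := r%:P; ring.
  exact: dvdp_mull.
have -> : p + v * M * (r%:P - p) - s%:P = (p - s%:P) + v * M * (r%:P - p).
  by rewrite addrAC.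
apply: dvdp_add; first exact: pP.
apply: dvdp_mulr; apply: dvdp_mull.
by rewrite /M (big_rem s) //=; apply: dvdp_mulr.
Qed.

End Jordan.

Section JordanClosed.
Context {F : closedFieldType} {n : nat}.
Implicit Types A B D N U P : 'M[F]_n.+1.

(** With [p] congruent to r modulo ('X - r)^k at each eigenvalue r, the product of the [p - r] is
    divisible by q^k and so kills [A]; thus p(A) is annihilated by a polynomial with simple roots.
    Also ['X - p] vanishes at every eigenvalue, so its k-th power kills [A]. *)
Lemma jordan_poly A : exists p : {poly F},
  diagonalizable (horner_mx A p) /\ nilpotent_mx (A - horner_mx A p).
Proof.
have [rs0 e0] := closed_field_poly_normal (char_poly A).
move: e0; rewrite (monicP (char_poly_monic A)) scale1r => e0.
pose rs := undup rs0; pose q := \prod_(r <- rs) ('X - r%:P).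
(* [size rs0] factors already suffice for [dq]; the successor makes the exponent visibly positive,
   so that ['X - r%:P] divides its k-th power at the end. *)
pose k := (size rs0).+1.
have dq : char_poly A %| q ^+ k.
  rewrite e0 /k exprS; apply: dvdp_mull.
  have : forall z, z \in rs0 -> 'X - z%:P %| q.
    move=> z zrs; rewrite /q (big_rem z) ?mem_undup //=.
    exact: dvdp_mulr.
  elim: (rs0) => [|z s IH] zq; first by rewrite big_nil expr0 dvdpp.
  rewrite big_cons /= exprS; apply: dvdp_mul; first by rewrite zq ?mem_head.
  by apply: IH => w ws; rewrite zq // inE ws orbT.
have kill (f : {poly F}) : q ^+ k %| f -> horner_mx A f = 0.
  move=> qf; apply/eqP; rewrite -dvd_mxminpoly.
  exact: (dvdp_trans (mxminpoly_dvd_char A) (dvdp_trans dq qf)).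
have [p pP] := chinese_root_poly rs k (undup_uniq _).
exists p; split.
  apply/diagonalizableP; exists rs; first exact: undup_uniq.
  rewrite dvd_mxminpoly; apply/eqP.
  rewrite rmorph_prod /=.
  have -> : \prod_(i <- rs) horner_mx (horner_mx A p) ('X - i%:P)
     = horner_mx A (\prod_(i <- rs) (p - i%:P)).
    rewrite rmorph_prod; apply: eq_bigr => i _.
    by rewrite !rmorphB /= horner_mx_X !horner_mx_C.
  apply: kill; rewrite /q -prodrXl.
  elim: (rs) pP => [|r s IH] pP; first by rewrite !big_nil dvdpp.
  rewrite !big_cons; apply: dvdp_mul; first by rewrite pP ?mem_head.
  by apply: IH => w ws; rewrite pP // inE ws orbT.
exists k; have -> : A - horner_mx A p = horner_mx A ('X - p).
  by rewrite rmorphB /= horner_mx_X.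
rewrite -rmorphXn; apply: kill; apply: dvdp_exp2r.
apply: uniq_roots_dvdp; last by rewrite uniq_rootsE undup_uniq.
apply/allP=> r rrs; rewrite -dvdp_XsubCl.
have -> : 'X - p = ('X - r%:P) - (p - r%:P) by ring.
apply: dvdp_sub => //; apply: dvdp_trans (pP r rrs).
by rewrite /k exprS dvdp_mulr.
Qed.

(** Covers a decomposition that is given rather than constructed: [D] and the polynomial part of [A]
    commute and both differ from [A] by a nilpotent, so uniqueness identifies them. *)
Lemma semisimple_part_poly A D U : A = D *m U -> D *m U = U *m D ->
  diagonalizable D -> nilpotent_mx (U - 1%:M) ->
  exists p : {poly F}, D = horner_mx A p.
Proof.
move=> AE cDU dD nU.
have [p [dp np]] := jordan_poly A; exists p.
have cAD : A *m D = D *m A by rewrite AE -mulmxA -cDU.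
have cDp : D *m horner_mx A p = horner_mx A p *m D.
  exact: comm_mx_horner.
have nAD : nilpotent_mx (A - D).
  have -> : A - D = D *m (U - 1%:M) by rewrite mulmxBr mulmx1 AE.
  by apply: nilpotent_mxMl => //; rewrite mulmxBl mulmxBr mulmx1 mul1mx cDU.
apply: diagonalizable_nilpotent_eq => //.
have -> : D - horner_mx A p = (A - horner_mx A p) + - (A - D).
  by rewrite opprB [RHS]addrC addrA subrK.
apply: nilpotent_mxD => //; last exact: nilpotent_mxN.
have cA : A *m horner_mx A p = horner_mx A p *m A by exact: comm_mx_horner.
rewrite mulmxN mulNmx; congr (- _).
apply: comm_mxB; apply: comm_mx_sym; apply: comm_mxB => //.
Qed.

Lemma horner_mx_eigenvector A (p : {poly F}) (v : 'cV[F]_n.+1) l :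
  A *m v = l *: v -> horner_mx A p *m v = p.[l] *: v.
Proof.
move=> Av; elim/poly_ind: p => [|p c IH].
  by rewrite rmorph0 horner0 mul0mx scale0r.
rewrite rmorphD rmorphM /= horner_mx_X horner_mx_C !hornerE mulmxDl.
by rewrite -[_ * A]/(_ *m A) -mulmxA Av -scalemxAr IH mul_scalar_mx scalerA scalerDl mulrC.
Qed.

End JordanClosed.

(** * Eigenbases and multiplicities *)

Section SpectralConsequences.
Context {F : fieldType} {n : nat}.
Implicit Types A B D N U P : 'M[F]_n.+1.

Lemma comm_invmx A B : A *m B = B *m A -> invmx A *m B = B *m invmx A.
Proof. by move=> cAB; apply/esym/(@commrV _ B A)/esym. Qed.

Lemma diagonalizable_eigenbasis A : diagonalizable A ->
  exists2 Q, Q \in unitmx &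
    forall j, exists l, A *m col j Q = l *: col j Q.
Proof.
case/diagonalizableW=> P Pu [d dE]; exists (invmx P); first by rewrite unitmx_inv.
move=> j; exists (d 0 j).
have e : A *m invmx P = invmx P *m diag_mx d.
  by rewrite -dE !mulmxA mulVmx // mul1mx.
rewrite colE mulmxA e -mulmxA scalemxAr; congr (_ *m _).
by apply/colP=> i; rewrite mul_diag_mx !mxE; case: eqP => [->|]; rewrite ?mulr0.
Qed.

Lemma char_poly_conj P A : P \in unitmx ->
  char_poly (P *m A *m invmx P) = char_poly A.
Proof.
move=> Pu; rewrite /char_poly /char_poly_mx.
set X := 'X%:M.
have PV : map_mx polyC P *m map_mx polyC (invmx P) = 1%:M :> 'M_n.+1.
  by rewrite -map_mxM mulmxV // map_mx1.
have -> : X - map_mx polyC (P *m A *m invmx P)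
    = map_mx polyC P *m (X - map_mx polyC A) *m map_mx polyC (invmx P).
  rewrite mulmxBr mulmxBl !map_mxM; congr (_ - _).
  by rewrite scalar_mxC -mulmxA PV mulmx1.
by rewrite !det_mulmx mulrAC -det_mulmx PV det1 mul1r.
Qed.

(** In diagonalizing coordinates an eigenvector for [l] is supported on positions carrying [l].
    Subtracting from [w] the multiple of [z] that cancels coordinate [i] leaves a nonzero
    eigenvector, whose support yields a second position. *)
Lemma diagonalizable_mup_ge2 A (z w : 'cV[F]_n.+1) l : diagonalizable A ->
  A *m z = l *: z -> A *m w = l *: w -> z != 0 -> (forall c, w != c *: z) ->
  (2 <= mup l (char_poly A))%N.
Proof.
case/diagonalizableW=> P Pu [d dE] Az Aw zn0 zw.
have eig (v : 'cV[F]_n.+1) i : A *m v = l *: v -> (P *m v) i 0 != 0 -> d 0 i = l.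
  move=> Av vi; apply: (mulIf vi).
  have : diag_mx d *m (P *m v) = l *: (P *m v).
    by rewrite -dE mulmxA mulmxKV // -mulmxA Av scalemxAr.
  by move=> /colP/(_ i); rewrite mul_diag_mx [LHS]mxE [RHS]mxE.
have nz (v : 'cV[F]_n.+1) : v != 0 -> exists i, (P *m v) i 0 != 0.
  move=> vn0; case: (pickP (fun i => (P *m v) i 0 != 0)) => [i|H].
    by exists i.
  have Pv : P *m v = 0.
    by apply/colP=> i; rewrite [RHS]mxE; apply/eqP/negPn; rewrite H.
  by move: vn0; rewrite -(mulKmx Pu v) Pv mulmx0 eqxx.
have [i zi] := nz z zn0.
pose c := (P *m w) i 0 / (P *m z) i 0.
have wn0 : w - c *: z != 0.
  by rewrite subr_eq0 zw.
have [j wj] := nz _ wn0.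
have Awz : A *m (w - c *: z) = l *: (w - c *: z).
  by rewrite mulmxBr -scalemxAr Az Aw scalerBr !scalerA mulrC.
have ji : j != i.
  apply: contraNneq wj => ->.
  rewrite mulmxBr -scalemxAr /c; move: (P *m w) (P *m z) zi => a b bi.
  by rewrite !mxE divfK // subrr.
rewrite mup_geq ?monic_neq0 ?char_poly_monic //.
rewrite -(char_poly_conj P) // dE char_poly_trig ?diag_mx_is_trig //.
rewrite (bigD1 i) // (bigD1 j) //= !mxE !eqxx !mulr1n (eig _ _ Az zi).
by rewrite (eig _ _ Awz wj) mulrA -expr2 dvdp_mulr.
Qed.

End SpectralConsequences.

(** * Hermitian forms and unipotent isometries *)

Section Hermitian.
Context {C : numClosedFieldType}.

Lemma trmxC_mul m n p (A : 'M[C]_(m, n)) (B : 'M[C]_(n, p)) :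
  (A *m B) ^t* = B ^t* *m A ^t*.
Proof. by rewrite trmx_mul map_mxM. Qed.

Context {m : nat}.
Implicit Types (J U g A B : 'M[C]_m) (x y z w : 'cV[C]_m) (L : 'rV[C]_m).

Lemma hformDl J x y w : hform J (x + y) w = hform J x w + hform J y w.
Proof. by rewrite /hform mulmxDr mxE. Qed.

Lemma hformZl J c z w : hform J (c *: z) w = c * hform J z w.
Proof. by rewrite /hform -scalemxAr mxE. Qed.

Lemma hformDr J z x y : hform J z (x + y) = hform J z x + hform J z y.
Proof. by rewrite /hform linearD map_mxD !mulmxDl mxE. Qed.

Lemma hformZr J c z w : hform J z (c *: w) = c^* * hform J z w.
Proof. by rewrite /hform linearZ /= map_mxZ -!scalemxAl mxE. Qed.

Lemma hform0l J w : hform J 0 w = 0.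
Proof. by rewrite /hform mulmx0 mxE. Qed.

Lemma hformNl J z w : hform J (- z) w = - hform J z w.
Proof. by rewrite -scaleN1r hformZl mulN1r. Qed.

Lemma hformNr J z w : hform J z (- w) = - hform J z w.
Proof. by rewrite -scaleN1r hformZr rmorphN1 mulN1r. Qed.

Lemma hformBl J x y w : hform J (x - y) w = hform J x w - hform J y w.
Proof. by rewrite hformDl hformNl. Qed.

Lemma hform_conj J z w : J ^t* = J -> (hform J z w)^* = hform J w z.
Proof.
move=> hJ; have -> : (hform J z w)^* = ((w ^t* *m J *m z) ^t*) 0 0.
  by rewrite [RHS]mxE [_^T _ _]mxE.
by rewrite !trmxC_mul hJ trmxCK mulmxA.
Qed.

Lemma hform_real J z : J ^t* = J -> hform J z z \is Num.real.
Proof. by move=> hJ; rewrite CrealE hform_conj. Qed.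

Lemma hform_mul k J (A B : 'M[C]_(m, k)) (z w : 'cV_k) :
  hform J (A *m z) (B *m w) = hform (B ^t* *m J *m A) z w.
Proof. by rewrite /hform trmxC_mul !mulmxA. Qed.

Lemma hform_isU J g z w : isU J g -> hform J (g *m z) (g *m w) = hform J z w.
Proof. by rewrite hform_mul => ->. Qed.

Lemma isU_unit J g : J \in unitmx -> isU J g -> g \in unitmx.
Proof.
rewrite !unitmxE => Ju /(congr1 determinant).
rewrite !det_mulmx => e; move: Ju; rewrite -e unitrM => /andP[_ gu].
exact: gu.
Qed.

(** A functional [L] encodes that at most one direction is nonpositive: any two vectors have a
    combination in its kernel, on which definiteness can be tested without an orthogonal basis. *)
Definition lorentzian J L : Prop :=
  J ^t* = J /\ forall z, L *m z = 0 -> z != 0 -> 0 < hform J z z.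

Section Lorentzian.
Variables (J : 'M[C]_m) (L : 'rV[C]_m).
Hypothesis lorJ : lorentzian J L.

Let hJ : J ^t* = J. Proof. by case: lorJ. Qed.

(* The combination of x and y killed by L is both nonnegative and nonpositive. *)
Lemma nonpos_orthogonal_proportional x y : hform J x x <= 0 ->
  hform J y y <= 0 -> hform J x y = 0 -> x != 0 -> proportional x y.
Proof.
move=> x0 y0 xy xn0; have [_ pos] := lorJ.
pose a := (L *m x) 0 0; pose b := (L *m y) 0 0.
have an0 : a != 0.
  apply: contraTneq x0 => a0; rewrite -real_ltNge ?hform_real ?real0 //.
  apply: pos => //; apply/matrixP=> i j; rewrite !ord1 [RHS]mxE; exact: a0.
have w0 : b *: x - a *: y = 0.
  apply/eqP/negPn/negP => /pos /=; rewrite mulmxBr -!scalemxAr => pw.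
  have /pw : b *: (L *m x) - a *: (L *m y) = 0.
    rewrite (mx11_scalar (L *m x)) (mx11_scalar (L *m y)) -/a -/b.
    by rewrite !scale_scalar_mx mulrC subrr.
  apply/negP; rewrite -real_leNgt ?hform_real ?real0 //.
  rewrite -scaleNr !hformDl !hformDr !hformZl !hformZr.
  rewrite -(hform_conj _ x y) // xy conjC0 !mulr0 addr0 add0r !mulrA -!normCK.
  by rewrite -[leRHS]addr0 lerD // mulr_ge0_le0 ?exprn_ge0.
exists (b / a); apply/eqP; rewrite -subr_eq0 -(inj_eq (scalerI an0)) scaler0.
by rewrite scalerBr scalerA mulrCA divff // mulr1 -oppr_eq0 opprB w0.
Qed.

Lemma orthogonal_neg_pos z y : negv J z -> hform J y z = 0 -> y != 0 ->
  0 < hform J y y.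
Proof.
move=> nz yz yn0; rewrite real_ltNge ?hform_real ?real0 //; apply/negP=> y0.
have [c yE] : proportional z y.
  apply: nonpos_orthogonal_proportional => //; first exact: ltW.
    by rewrite -hform_conj // yz conjC0.
  by apply: contraTneq nz => ->; rewrite /negv hform0l ltxx.
move/eqP: yz; rewrite yE hformZl mulf_eq0 (lt_eqF nz) orbF => /eqP c0.
by move: yn0; rewrite yE c0 scale0r eqxx.
Qed.

Lemma null_orthogonal_proportional x y : nullv J x -> nullv J y ->
  hform J x y = 0 -> proportional x y.
Proof.
by move=> [xn0 x0] [_ y0] xy; apply: nonpos_orthogonal_proportional;
  rewrite ?x0 ?y0.
Qed.

(* x + t y has square norm 2 Re (t^* <x, y>), which is negative for t = - <x, y>. *)
Lemma null_span_neg x y : hform J x x = 0 -> hform J y y = 0 ->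
  hform J x y != 0 -> exists c, negv J (x + c *: y).
Proof.
move=> x0 y0 xy; exists (- hform J x y); rewrite /negv.
rewrite !hformDl !hformDr !hformZl !hformZr x0 y0 -(hform_conj _ x y) //.
rewrite add0r !mulr0 addr0 rmorphN !mulNr -normCK [_^* * _]mulrC -normCK.
by rewrite -mulr2n pmulrn_llt0 // oppr_lt0 exprn_gt0 // normr_gt0.
Qed.

End Lorentzian.
End Hermitian.

Lemma mulmx_colP (F : pzRingType) m n (A B : 'M[F]_(m, n)) :
  (forall v : 'cV_n, A *m v = B *m v) -> A = B.
Proof.
move=> AB; apply/matrixP=> i j; have := AB (delta_mx j 0).
by rewrite -!colE => /colP/(_ i); rewrite [LHS]mxE [RHS]mxE.
Qed.

(** * Unipotent isometries *)

Section Unipotent.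
Context {C : numClosedFieldType} {n : nat}.
Implicit Types (J U g A B : 'M[C]_n.+1) (x y z w : 'cV[C]_n.+1).

Lemma eigenvalue_ofP g l :
  eigenvalue_of g l <-> exists2 v : 'cV_n.+1, v != 0 & g *m v = l *: v.
Proof.
(* [eigenvalue] speaks of row vectors; transposition keeps the characteristic polynomial and turns
   them into columns. *)
have -> : eigenvalue_of g l <-> eigenvalue g^T l.
  rewrite eigenvalue_root_char /eigenvalue_of.
  suff -> : char_poly g = char_poly g^T by [].
  rewrite /char_poly -det_tr /char_poly_mx.
  by rewrite linearB /= tr_scalar_mx map_trmx.
split=> [/eigenvalueP[v gv vn0]|[v vn0 gv]].
  exists v^T; first by rewrite trmx_eq0.
  by apply: trmx_inj; rewrite trmx_mul trmxK linearZ /= trmxK.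
apply/eigenvalueP; exists v^T; rewrite ?trmx_eq0 //.
by rewrite -trmx_mul gv linearZ.
Qed.

Lemma expmx_eigenvector g (v : 'cV[C]_n.+1) (l : C) k : g *m v = l *: v ->
  (g ^+ k) *m v = l ^+ k *: v.
Proof.
move=> gv; elim: k => [|k IH]; first by rewrite !expr0 mul1mx scale1r.
by rewrite exprS -[g * _]/(g *m _) -mulmxA IH -scalemxAr gv scalerA -exprSr.
Qed.

Lemma unipotentP g : unipotent g <-> nilpotent_mx (g - 1%:M).
Proof.
split=> [ug|[k gk] l /eigenvalue_ofP[v vn0 gv]].
  have [rs e] := closed_field_poly_normal (char_poly g).
  move: e; rewrite (monicP (char_poly_monic g)) scale1r => e.
  exists (size rs); have := Cayley_Hamilton g; rewrite e.
  have -> : \prod_(z <- rs) ('X - z%:P) = ('X - 1%:P) ^+ (size rs).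
    rewrite (eq_big_seq (fun=> 'X - 1%:P)) => [|z zrs].
      by rewrite big_tnth prodr_const card_ord.
    by rewrite (ug z) // /eigenvalue_of e root_prod_XsubC.
  by rewrite rmorphXn rmorphB /= horner_mx_X horner_mx_C.
have gv1 : (g - 1%:M) *m v = (l - 1) *: v.
  by rewrite mulmxBl mul1mx gv scalerBl scale1r.
have := expmx_eigenvector _ _ _ k gv1; rewrite gk mul0mx => /esym/eqP.
by rewrite scaler_eq0 (negPf vn0) orbF expf_eq0 subr_eq0 => /andP[_ /eqP].
Qed.

Lemma unipotent_fixes U z : unipotent U -> z != 0 -> fixes U z -> U *m z = z.
Proof.
move=> uU zn0 [l Uz]; rewrite Uz (uU l) ?scale1r //.
by apply/eigenvalue_ofP; exists z.
Qed.

(* If v = N u and N v is in the radical of W, then the invariance of <u, v>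
   under U = 1 + N reads <v, v> = 0. *)
Lemma unipotent_null_shift J U (W : 'cV[C]_n.+1 -> Prop) :
  J ^t* = J -> isU J U -> nilpotent_mx (U - 1%:M) ->
  (forall z, W z -> W ((U - 1%:M) *m z)) ->
  (forall z w, W z -> W w -> hform J z z = 0 -> hform J w z = 0) ->
  forall z, W z -> hform J ((U - 1%:M) *m z) ((U - 1%:M) *m z) = 0.
Proof.
move=> hJ UJ [k Nk] WN Wrad; set N := U - 1%:M in Nk WN *.
have WNk i z : W z -> W (N ^+ i *m z).
  elim: i => [|i IH] Wz; first by rewrite expr0 mul1mx.
  by rewrite exprS -[N * _]/(N *m _) -mulmxA; apply/WN/IH.
(* Nilpotency makes a high power of [N] send [z] to the null vector 0; nullity is then carried down
   one power at a time. *)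
suff H i z : W z -> hform J (N ^+ i.+1 *m z) (N ^+ i.+1 *m z) = 0 ->
    hform J (N *m z) (N *m z) = 0.
  by move=> z Wz; apply: (H k) => //; rewrite exprSr Nk mul0r mul0mx hform0l.
elim: i => [|i IH] Wz; first by rewrite expr1.
have NS j : N ^+ j.+1 *m z = N *m (N ^+ j *m z).
  by rewrite exprS -[N * _]/(N *m _) mulmxA.
set u := N ^+ i *m z; set v := N *m u.
have vE : N ^+ i.+1 *m z = v by rewrite NS.
rewrite NS vE => r0; apply: IH => //; rewrite vE.
have Wu : W u by exact: WNk.
have Wv : W v by exact: WN.
have WNv : W (N *m v) by exact: WN.
have UE w : U *m w = w + N *m w by rewrite mulmxBl mul1mx addrC subrK.
have := hform_isU _ _ u v UJ; rewrite !UE -/v hformDr !hformDl.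
rewrite [hform J u (N *m v)]Wrad //.
rewrite [hform J v (N *m v)]Wrad //.
rewrite !addr0 => /(congr1 (fun t => t - hform J u v)).
by rewrite subrr addrAC subrr add0r.
Qed.

Lemma isU_shift J U x w : isU J U -> U *m x = x ->
  hform J ((U - 1%:M) *m w) x = 0.
Proof.
move=> UJ Ux; rewrite mulmxBl mul1mx hformBl -{1}Ux hform_isU //.
by rewrite subrr.
Qed.

(** [U - 1] maps everything into the complement of [z], where the form is definite. The null vectors
    given by [unipotent_null_shift] are therefore 0 there, and [U - 1] also kills [z]. *)
Lemma unipotent_elliptic_id J L U z : lorentzian J L -> isU J U ->
  nilpotent_mx (U - 1%:M) -> negv J z -> U *m z = z -> U = 1%:M.
Proof.
move=> lorJ UJ nU nz Uz; have [hJ _] := lorJ.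
have W0 w : hform J w z = 0 -> hform J w w = 0 -> w = 0.
  move=> wz ww; apply/eqP/negPn/negP => wn0.
  by have := orthogonal_neg_pos _ _ lorJ _ _ nz wz wn0; rewrite ww ltxx.
have Nw w : hform J w z = 0 -> (U - 1%:M) *m w = 0.
  move=> wz; apply: (W0); first exact: isU_shift.
  apply: (unipotent_null_shift J U (fun w => hform J w z = 0)) => //.
    by move=> *; exact: isU_shift.
  move=> u v uz vz uu; rewrite (W0 u) // -hform_conj // hform0l conjC0 //.
apply/eqP; rewrite -subr_eq0; apply/eqP.
apply: mulmx_colP => w; rewrite mul0mx.
pose c := hform J w z / hform J z z.
have -> : w = (w - c *: z) + c *: z by rewrite subrK.
have Nz : (U - 1%:M) *m z = 0 by rewrite mulmxBl Uz mul1mx subrr.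
rewrite mulmxDr -scalemxAr Nz scaler0 addr0 Nw //.
by rewrite hformBl hformZl divfK ?subrr // lt_eqF.
Qed.

(** In the complement of [x] a null vector is a multiple of [x], hence orthogonal to that whole
    complement; this is the radical condition of [unipotent_null_shift]. *)
Lemma unipotent_null_orthogonal J L U x w : lorentzian J L -> isU J U ->
  nilpotent_mx (U - 1%:M) -> nullv J x -> U *m x = x -> hform J w x = 0 ->
  proportional x ((U - 1%:M) *m w).
Proof.
move=> lorJ UJ nU [xn0 x0] Ux wx; have [hJ _] := lorJ.
have W0 u : hform J u x = 0 -> hform J u u = 0 -> proportional x u.
  move=> ux uu; apply: (nonpos_orthogonal_proportional _ _ lorJ) => //.
  - by rewrite x0.
  - by rewrite uu.
  - by rewrite -hform_conj // ux conjC0.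
apply: (W0); first exact: isU_shift.
apply: (unipotent_null_shift J U (fun w => hform J w x = 0)) => //.
  by move=> *; exact: isU_shift.
by move=> u v ux vx uu; have [c ->] := W0 u ux uu; rewrite hformZr vx mulr0.
Qed.

End Unipotent.

(** * Unitary Jordan decomposition and commuting isometries *)

Section IndefiniteUnitary.
Context {C : numClosedFieldType} {n : nat} (J : 'M[C]_n.+1).
Hypothesis Ju : J \in unitmx.
Implicit Types (S T U A B : 'M[C]_n.+1) (x y z w : 'cV[C]_n.+1).

Lemma isUM A B : isU J A -> isU J B -> isU J (A *m B).
Proof.
move=> uA uB; rewrite /isU trmxC_mul -[RHS]uB -[in RHS]uA.
by rewrite !mulmxA.
Qed.

Lemma isUV A : isU J A -> isU J (invmx A).
Proof.
move=> uA; have Au := isU_unit _ _ Ju uA.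
rewrite /isU -{1}uA !mulmxA -trmxC_mul mulmxV // trmx1 map_mx1 mul1mx.
by rewrite -mulmxA mulmxV // mulmx1.
Qed.

(** The adjoint for the form: <hadj A z, w> = <z, A w>. *)
Definition hadj A := invmx J *m A ^t* *m J.

Lemma hadjM A B : hadj (A *m B) = hadj B *m hadj A.
Proof. by rewrite /hadj trmxC_mul !mulmxA mulmxK. Qed.

Lemma hadj_sub1 A : hadj (A - 1%:M) = hadj A - 1%:M.
Proof.
by rewrite /hadj linearB /= map_mxB trmx1 map_mx1 mulmxBr mulmxBl mulmx1 mulVmx.
Qed.

Lemma isU_hadj A : isU J A <-> hadj A *m A = 1%:M.
Proof.
split=> [uA|]; first by rewrite /hadj -!mulmxA (mulmxA _ J) uA mulVmx.
by move=> /(congr1 (mulmx J)); rewrite /hadj !mulmxA mulmxV // mul1mx mulmx1.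
Qed.

Lemma hadj_nilpotent A : nilpotent_mx A -> nilpotent_mx (hadj A).
Proof.
case=> k Ak; exists k; suff -> : hadj A ^+ k = hadj (A ^+ k).
  by rewrite Ak /hadj linear0 map_mx0 mulmx0 mul0mx.
elim: k {Ak} => [|k IH].
  by rewrite !expr0 /hadj trmx1 map_mx1 mulmx1 mulVmx.
by rewrite exprSr IH exprS -[A * _]/(A *m _) hadjM.
Qed.

Lemma hadj_diagonalizable A : diagonalizable A -> diagonalizable (hadj A).
Proof.
case/diagonalizableW=> P Pu [d dE].
have Pu' : P ^t* \in unitmx by rewrite map_unitmx unitmx_tr.
have AE : A = invmx P *m diag_mx d *m P.
  by rewrite -dE !mulmxA mulVmx // mul1mx mulmxKV.
exists (invmx (P ^t*) *m J); first by rewrite unitmx_mul unitmx_inv Pu'.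
apply/diagonalizable_forPex; exists (map_mx Num.conj d).
apply/simmxP; first by rewrite unitmx_mul unitmx_inv Pu'.
rewrite /hadj {1}AE !trmxC_mul tr_diag_mx map_diag_mx !mulmxA mulmxK //.
rewrite mulVmx // mul1mx -!mulmxA; congr (_ *m _).
by rewrite trmx_inv map_invmx.
Qed.

(** The adjoint of a unitary [S] is its inverse, so taking adjoints in the hypothesis gives
    commutation of [hadj A] with [invmx S]. *)
Lemma comm_hadj S A : isU J S -> S *m A = A *m S -> S *m hadj A = hadj A *m S.
Proof.
move=> uS cSA; have Su := isU_unit _ _ Ju uS.
have hS : hadj S = invmx S.
  by rewrite -[LHS]mulmx1 -(mulmxV Su) mulmxA (isU_hadj S).1 // mul1mx.
have e : invmx S *m hadj A = hadj A *m invmx S by rewrite -hS -!hadjM cSA.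
by have := comm_invmx _ _ e; rewrite invmxK.
Qed.

Lemma semisimple_part_unit S D : S \in unitmx -> S *m D = D *m S ->
  nilpotent_mx (S - D) -> D \in unitmx.
Proof.
move=> Su cSD nSD.
have -> : D = S *m (invmx S *m D) by rewrite mulmxA mulmxV // mul1mx.
rewrite unitmx_mul Su; apply: nilpotent_sub1_unit.
have -> : invmx S *m D - 1%:M = - (invmx S *m (S - D)).
  by rewrite mulmxBr mulVmx // opprB.
apply: nilpotent_mxN; apply: nilpotent_mxMl => //.
by apply: comm_invmx; rewrite mulmxBr mulmxBl cSD.
Qed.

(** Writing [S = D *m U], unitarity of [S] gives (D hadj D)(U hadj U) = 1. The first factor is
    diagonalizable and the second unipotent, so D hadj D differs from 1 by a nilpotent and equals 1
    by uniqueness. Then [U] is unitary as a quotient of unitaries. *)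
Lemma jordan_decomp_exists S : isU J S -> exists Ss Su, jordan_decomp J S Ss Su.
Proof.
move=> uS; have Sun := isU_unit _ _ Ju uS.
have [p [dD nN]] := jordan_poly S; set D := horner_mx S p in dD nN.
have cp B : S *m B = B *m S -> D *m B = B *m D.
  by move=> c; apply: comm_horner_mx.
have cSD : S *m D = D *m S by apply/esym/cp.
have Du : D \in unitmx by exact: semisimple_part_unit cSD nN.
pose U := invmx D *m S.
have SE : S = D *m U by rewrite mulmxA mulmxV // mul1mx.
have cDU : D *m U = U *m D by rewrite -SE /U -mulmxA cSD mulKmx.
have cU B : S *m B = B *m S -> U *m B = B *m U.
  move=> c; rewrite /U -mulmxA c !mulmxA; congr (_ *m _).
  exact/comm_invmx/cp.
have cSU : S *m U = U *m S by apply/esym/cU.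
have nU : nilpotent_mx (U - 1%:M).
  have -> : U - 1%:M = invmx D *m (S - D) by rewrite mulmxBr mulVmx.
  apply: nilpotent_mxMl => //; apply: comm_invmx.
  by rewrite mulmxBr mulmxBl cSD.
have cDh := comm_hadj _ _ uS cSD.
have cUh := comm_hadj _ _ uS cSU.
have SSh : S *m hadj S = 1%:M by apply/mulmx1C/isU_hadj.
have EG : (D *m hadj D) *m (U *m hadj U) = 1%:M.
  rewrite mulmxA -(mulmxA D (hadj D) U) -(cU _ cDh) (mulmxA D U) -SE.
  by rewrite -mulmxA -hadjM -cDU -SE.
have DD : D *m hadj D = 1%:M.
  apply: diagonalizable_nilpotent_eq.
  - by rewrite mulmx1 mul1mx.
  - apply: diagonalizableM => //; first exact: cp.
    exact: hadj_diagonalizable.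
  - exact: diagonalizable_scalar.
  have cED : (D *m hadj D) *m (U *m hadj U) = (U *m hadj U) *m (D *m hadj D).
    by rewrite EG; apply/esym/mulmx1C.
  have -> : D *m hadj D - 1%:M = - ((D *m hadj D) *m (U *m hadj U - 1%:M)).
    by rewrite mulmxBr EG mulmx1 opprB.
  apply/nilpotent_mxN/nilpotent_mxMl.
    by rewrite mulmxBr mulmxBl mulmx1 mul1mx cED.
  (* The right-hand side is a sum of two commuting nilpotents. *)
  have -> : U *m hadj U - 1%:M = hadj U *m (U - 1%:M) + hadj (U - 1%:M).
    by rewrite hadj_sub1 mulmxBr mulmx1 addrA subrK (cU _ cUh).
  have c1 : hadj U *m (U - 1%:M) = (U - 1%:M) *m hadj U.
    by rewrite mulmxBr mulmxBl mulmx1 mul1mx (cU _ cUh).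
  have c2 : (U - 1%:M) *m hadj (U - 1%:M) = hadj (U - 1%:M) *m (U - 1%:M).
    by rewrite hadj_sub1 [LHS]mulmxBr [RHS]mulmxBl mulmx1 mul1mx c1.
  apply: nilpotent_mxD; last exact: hadj_nilpotent.
    rewrite -mulmxA c2 mulmxA [RHS]mulmxA; congr (_ *m _).
    by rewrite hadj_sub1 mulmxBr mulmxBl mulmx1 mul1mx.
  exact: nilpotent_mxMl.
have uD : isU J D by apply/isU_hadj/mulmx1C.
exists D, U; split=> //; last exact/unipotentP.
by split=> //; apply: isUM => //; exact: isUV.
Qed.

Section JordanDecomp.
Variables (T Ts Tu : 'M[C]_n.+1).
Hypothesis jT : jordan_decomp J T Ts Tu.

Lemma jordan_unipotent_part : Ts \in unitmx /\ Tu = invmx Ts *m T.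
Proof.
have [[us uu] ds nu -> cst] := jT.
have Tsu : Ts \in unitmx by exact: isU_unit us.
by rewrite mulmxA mulVmx // mul1mx.
Qed.

Lemma jordan_semisimple_poly : exists p : {poly C}, Ts = horner_mx T p.
Proof.
by have [_ ds /unipotentP nu TE cst] := jT; apply: semisimple_part_poly TE _ _ _.
Qed.

Lemma jordan_decomp_comm B : T *m B = B *m T ->
  Ts *m B = B *m Ts /\ Tu *m B = B *m Tu.
Proof.
move=> cTB; have [p pE] := jordan_semisimple_poly.
have [Tsu TuE] := jordan_unipotent_part.
have cs : Ts *m B = B *m Ts by rewrite pE; apply: comm_horner_mx.
split=> //; rewrite TuE -mulmxA cTB !mulmxA; congr (_ *m _).
exact: comm_invmx.
Qed.

(** [Ts] is a polynomial in [T], so an eigenvector of [T] is one of [Ts] and thus of [Tu];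
    unipotence makes the last eigenvalue 1. *)
Lemma jordan_unipotent_fixes z : z != 0 -> fixes T z -> Tu *m z = z.
Proof.
move=> zn0 [l Tz]; have [p pE] := jordan_semisimple_poly.
have [Tsu TuE] := jordan_unipotent_part.
have [_ _ uu _ _] := jT; apply: unipotent_fixes => //.
have Tsz : Ts *m z = p.[l] *: z by rewrite pE; apply: horner_mx_eigenvector.
have pn0 : p.[l] != 0.
  by apply: contraNneq zn0 => p0; rewrite -(mulKmx Tsu z) Tsz p0 scale0r mulmx0.
have Vz : invmx Ts *m z = (p.[l])^-1 *: z.
  by apply: (scalerI pn0); rewrite scalerA mulfV // scale1r scalemxAr -Tsz mulKmx.
by exists (l / p.[l]); rewrite TuE -mulmxA Tz -scalemxAr Vz scalerA.
Qed.

End JordanDecomp.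

Lemma comm_preserves_eigenspaces S T : S \in unitmx -> T *m S = S *m T ->
  preserves_eigenspaces S T.
Proof.
move=> Su cTS l _; split=> z Tz; rewrite /eigenspace_of in Tz *.
  by rewrite mulmxA cTS -mulmxA Tz scalemxAr.
exists (invmx S *m z); split; last by rewrite mulmxA mulmxV // mul1mx.
by rewrite mulmxA -(comm_invmx _ _ (esym cTS)) -mulmxA Tz scalemxAr.
Qed.

Lemma diagonalizable_comm_eigenspaces S T : S \in unitmx -> diagonalizable T ->
  T *m S = S *m T <-> preserves_eigenspaces S T.
Proof.
move=> Su dT; split; first exact: comm_preserves_eigenspaces.
move=> pST; have [Q Qu QE] := diagonalizable_eigenbasis _ dT.
suff e : T *m S *m Q = S *m T *m Q by rewrite -[LHS](mulmxK Qu) e mulmxK.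
apply/matrixP=> i j; have [l Tq] := QE j.
have qn0 : col j Q != 0.
  apply/negP=> /eqP q0; move: (mulKmx Qu (delta_mx j 0 : 'cV[C]_n.+1)).
  rewrite -colE q0 mulmx0 => /colP/(_ j); rewrite !mxE !eqxx /= => /eqP.
  by rewrite eq_sym oner_eq0.
have [pS _] : preserves S (eigenspace_of T l).
  by apply: pST; apply/eigenvalue_ofP; exists (col j Q).
have := pS _ Tq; rewrite /eigenspace_of => Sq.
suff : col j (T *m S *m Q) = col j (S *m T *m Q).
  by move=> /colP/(_ i); rewrite [LHS]mxE [RHS]mxE.
by rewrite !colE -!mulmxA -!colE Sq Tq scalemxAr.
Qed.

Lemma comm_preserves_fixpts S T : isU J T -> T *m S = S *m T ->
  preserves T (fixpts J S).
Proof.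
move=> uT cTS; have Tu := isU_unit _ _ Ju uT.
have H A z : isU J A -> A *m S = S *m A -> fixpts J S z -> fixpts J S (A *m z).
  move=> uA cAS [[zn0 nz] [l Sz]]; have Au := isU_unit _ _ Ju uA.
  split; last by exists l; rewrite mulmxA -cAS -mulmxA Sz scalemxAr.
  split; last by rewrite hform_isU.
  by apply: contraNneq zn0 => Az; rewrite -(mulKmx Au z) Az mulmx0.
split=> z fz; first exact: H.
exists (invmx T *m z); split; last by rewrite mulmxA mulmxV // mul1mx.
by apply: H => //; [exact: isUV | exact: comm_invmx].
Qed.

(** * Fixed points of commuting isometries *)

Section Lorentzian.
Variable L : 'rV[C]_n.+1.
Hypothesis lorJ : lorentzian J L.

Lemma elliptic_diagonalizable T : isU J T -> elliptic J T -> diagonalizable T.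
Proof.
move=> uT [z [nz fz]]; have [Ts [Tu jT]] := jordan_decomp_exists _ uT.
have zn0 : z != 0 by apply: contraTneq nz => ->; rewrite /negv hform0l ltxx.
have Tuz := jordan_unipotent_fixes _ _ _ jT _ zn0 fz.
have [[_ uu] ds /unipotentP nu -> _] := jT.
by rewrite (unipotent_elliptic_id _ _ _ _ lorJ uu nu nz Tuz) mulmx1.
Qed.

Lemma null_pair_hform x y : nullv J x -> nullv J y -> ~ proportional x y ->
  hform J x y != 0.
Proof.
move=> nx ny xy; apply/eqP => h; apply: xy.
exact: (null_orthogonal_proportional _ _ lorJ).
Qed.

(** The unipotent part fixes both null vectors, hence their span, which contains a negative vector;
    so it is trivial. *)
Lemma two_null_fixed_diagonalizable T x y : isU J T ->
  nullv J x -> nullv J y -> ~ proportional x y -> fixes T x -> fixes T y ->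
  diagonalizable T.
Proof.
move=> uT nx ny xy fx fy; have [Ts [Tu jT]] := jordan_decomp_exists _ uT.
have [c nc] := null_span_neg _ _ lorJ _ _ nx.2 ny.2 (null_pair_hform _ _ nx ny xy).
have Tux := jordan_unipotent_fixes _ _ _ jT _ nx.1 fx.
have Tuy := jordan_unipotent_fixes _ _ _ jT _ ny.1 fy.
have [[_ uu] ds /unipotentP nu -> _] := jT.
rewrite (unipotent_elliptic_id _ _ _ _ lorJ uu nu nc) ?mulmx1 //.
by rewrite mulmxDr -scalemxAr Tux Tuy.
Qed.

Lemma null_pair_eigenvalues T x y a b : isU J T ->
  nullv J x -> nullv J y -> ~ proportional x y ->
  T *m x = a *: x -> T *m y = b *: y -> a * b^* = 1.
Proof.
move=> uT nx ny xy Tx Ty; have h := null_pair_hform _ _ nx ny xy.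
apply: (mulIf h); rewrite mul1r -[RHS](hform_isU _ _ _ _ uT) Tx Ty.
by rewrite hformZl hformZr mulrA.
Qed.

Lemma null_pair_elliptic T x y a : nullv J x -> nullv J y ->
  ~ proportional x y -> T *m x = a *: x -> T *m y = a *: y -> elliptic J T.
Proof.
move=> nx ny xy Tx Ty.
have [c nc] := null_span_neg _ _ lorJ _ _ nx.2 ny.2 (null_pair_hform _ _ nx ny xy).
exists (x + c *: y); split=> //; exists a.
by rewrite mulmxDr -scalemxAr Tx Ty scalerDr !scalerA mulrC.
Qed.

Lemma null_mul T x : isU J T -> nullv J x -> nullv J (T *m x).
Proof.
move=> uT [xn0 x0]; have Tu := isU_unit _ _ Ju uT.
split; last by rewrite hform_isU.
by apply: contraNneq xn0 => Tx; rewrite -(mulKmx Tu x) Tx mulmx0.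
Qed.

(** The fixed point in [parabolic] is existentially quantified; this transfers its uniqueness to any
    given representative [x]. *)
Lemma parabolic_unique T x y : parabolic J T -> nullv J x -> fixes T x ->
  nullv J y -> fixes T y -> proportional x y.
Proof.
move=> [_ [x0 [_ _ Hx0]]] nx fx ny fy.
have [c xE] := Hx0 _ nx fx; have [d yE] := Hx0 _ ny fy.
have c0 : c != 0.
  by have [xn0 _] := nx; apply: contraNneq xn0 => c0; rewrite xE c0 scale0r.
by exists (d / c); rewrite xE scalerA divfK.
Qed.

Lemma parabolic_comm_fixes S T x : isU J S -> parabolic J T -> nullv J x ->
  fixes T x -> T *m S = S *m T -> fixes S x.
Proof.
move=> uS pT nx fx cTS.
apply: (parabolic_unique T x (S *m x)) => //; first exact: null_mul.
by have [l Tx] := fx; exists l; rewrite mulmxA cTS -mulmxA Tx scalemxAr.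
Qed.

(* Otherwise <y, w> <> 0, so |b| = 1 and a = b, and then the span of x and y
   contains a negative eigenvector. *)
Lemma null_eigenline S x y w a b : isU J S -> ~ elliptic J S ->
  nullv J x -> nullv J y -> ~ proportional x y ->
  S *m x = a *: x -> S *m y = b *: y ->
  nullv J w -> S *m w = b *: w -> proportional y w.
Proof.
move=> uS neS nx ny xy Sx Sy nw Sw.
have [k0|k0] := eqVneq (hform J y w) 0.
  exact: (null_orthogonal_proportional _ _ lorJ).
exfalso; have yw : ~ proportional y w.
  by case=> c wE; move: k0; rewrite wE hformZr ny.2 mulr0 eqxx.
have ab := null_pair_eigenvalues _ _ _ _ _ uS nx ny xy Sx Sy.
have bb := null_pair_eigenvalues _ _ _ _ _ uS ny nw yw Sy Sw.
apply: neS; apply: null_pair_elliptic nx ny xy Sx _.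
suff -> : a = b by [].
have bn0 : b^* != 0.
  apply/negP=> /eqP b0; move: ab; rewrite b0 mulr0 => /eqP.
  by rewrite eq_sym oner_eq0.
by apply: (mulIf bn0); rewrite ab bb.
Qed.

Lemma parabolic_comm_parabolic S T x : isU J S -> isU J T -> parabolic J T ->
  nullv J x -> fixes T x -> T *m S = S *m T -> ~ elliptic J S -> parabolic J S.
Proof.
move=> uS uT pT nx fx cTS neS; split=> //.
have fSx := parabolic_comm_fixes _ _ _ uS pT nx fx cTS.
exists x; split=> // y ny [b Sy]; have [a Sx] := fSx.
have [h0|h0] := eqVneq (hform J x y) 0.
  exact: (null_orthogonal_proportional _ _ lorJ).
have xy : ~ proportional x y.
  by case=> c yE; move: h0; rewrite yE hformZr nx.2 mulr0 eqxx.
apply: (parabolic_unique T x y) => //.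
apply: (null_eigenline S x y (T *m y) a b) => //; first exact: null_mul.
by rewrite mulmxA -cTS -mulmxA Sy scalemxAr.
Qed.

Lemma nonelliptic_comm_boundary S T : isU J S -> isU J T -> ~ elliptic J T ->
  T *m S = S *m T -> elliptic J S -> boundary_elliptic J S.
Proof.
move=> uS uT neT cTS eS; have dS := elliptic_diagonalizable _ uS eS.
split=> //; have [z [nz [l Sz]]] := eS.
have zn0 : z != 0 by apply: contraTneq nz => ->; rewrite /negv hform0l ltxx.
exists l; split; first by exists z.
apply: (@diagonalizable_mup_ge2 _ _ S z (T *m z)) => //.
  by rewrite mulmxA -cTS -mulmxA Sz scalemxAr.
by move=> c; apply/eqP=> Tz; apply: neT; exists z; split=> //; exists c.
Qed.

(** [S] cannot exchange the two points: it preserves the eigenvalue of [T], and the eigenvalues at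
    [x] and [y] differ because [T] is not elliptic. *)
Lemma hyperbolic_comm_fixes S T x y : isU J S -> isU J T -> ~ elliptic J T ->
  nullv J x -> nullv J y -> ~ proportional x y -> fixes T x -> fixes T y ->
  T *m S = S *m T -> fixes S y.
Proof.
move=> uS uT neT nx ny xy [a Tx] [b Ty] cTS.
apply: (null_eigenline T x y (S *m y) a b) => //; first exact: null_mul.
by rewrite mulmxA cTS -mulmxA Ty scalemxAr.
Qed.

End Lorentzian.
End IndefiniteUnitary.

(** * The Siegel model *)

Lemma hform_stdsig (C : numClosedFieldType) n (z w : 'cV[C]_n.+1) :
  hform (stdsig C n) z w =
  \sum_(k | k != ord_max) z k 0 * (w k 0)^* - z ord_max 0 * (w ord_max 0)^*.
Proof.
rewrite /hform -mulmxA mul_diag_mx mxE (bigD1 ord_max) //= addrC !mxE eqxx.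
congr (_ + _); last by rewrite mulN1r mulrN mulrC.
by apply: eq_bigr => k /negPf kn; rewrite !mxE kn mul1r mulrC.
Qed.

Lemma stdsig_unit (C : numClosedFieldType) n : stdsig C n \in unitmx.
Proof.
rewrite unitmxE det_diag unitfE prodf_seq_neq0; apply/allP=> i _ /=.
by rewrite mxE; case: ifP => _; rewrite ?oppr_eq0 oner_eq0.
Qed.

Lemma hermitian_sig_unit (C : numClosedFieldType) n (J : 'M[C]_n.+1) :
  hermitian_sig J -> J \in unitmx.
Proof.
case=> _ [P [Pu ->]].
by rewrite !unitmx_mul Pu andbT map_unitmx unitmx_tr Pu stdsig_unit.
Qed.

Lemma hermitian_sig_lorentzian (C : numClosedFieldType) n (J : 'M[C]_n.+1) :
  hermitian_sig J -> exists L, lorentzian J L.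
Proof.
(* The functional is the coordinate with sign -1 in the frame that diagonalizes the form. *)
case=> hJ [P [Pu JE]]; exists (row ord_max P); split=> // z Lz zn0.
have Pz : (P *m z) ord_max 0 = 0.
  by move: Lz; rewrite -row_mul => /rowP/(_ 0); rewrite !mxE.
rewrite JE -hform_mul hform_stdsig Pz mul0r subr0.
rewrite lt_def sumr_ge0 ?andbT => [|k _]; last by rewrite -normCK exprn_ge0.
apply: contraNneq zn0 => /eqP s0; rewrite -(mulKmx Pu z).
suff -> : P *m z = 0 by rewrite mulmx0.
apply/colP=> k; rewrite [RHS]mxE; have [->//|km] := eqVneq k ord_max.
move: s0; rewrite psumr_eq0 => [|i _]; last by rewrite -normCK exprn_ge0.
move/allP/(_ k); rewrite mem_index_enum km -normCK => /(_ isT)/eqP.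
by move/eqP; rewrite sqrf_eq0 normr_eq0 => /eqP.
Qed.

Lemma hform_inj (C : numClosedFieldType) m (A B : 'M[C]_m) :
  (forall z w, hform A z w = hform B z w) -> A = B.
Proof.
move=> AB; apply: mulmx_colP => z; apply/colP=> i; have := AB z (delta_mx i 0).
have E (M : 'M[C]_m) : hform M z (delta_mx i 0) = (M *m z) i 0.
  rewrite /hform trmx_delta -mulmxA.
  have -> : map_mx Num.conj (delta_mx 0 i : 'rV[C]_m) = delta_mx 0 i.
    by apply/rowP=> j; rewrite !mxE; case: (_ && _); rewrite ?conjC1 ?conjC0.
  by rewrite -rowE mxE.
by rewrite !E.
Qed.

(** The involutive reflection with normal [v]; [k] stands for 2/<v,v>. *)
Lemma reflection_isU (C : numClosedFieldType) m (J : 'M[C]_m) v k :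
  J ^t* = J -> k^* = k -> k * hform J v v = 2%:R ->
  exists K, isU J K /\ forall z, K *m z = z - (k * hform J z v) *: v.
Proof.
move=> hJ kk kv; pose K : 'M[C]_m := 1%:M - k *: (v *m (v ^t* *m J)).
have KE z : K *m z = z - (k * hform J z v) *: v.
  rewrite mulmxBl mul1mx -scalemxAl -mulmxA; congr (_ - _).
  by rewrite [_ *m z]mx11_scalar -/(hform J z v) mul_mx_scalar scalerA.
exists K; split=> //; apply: hform_inj => z w; rewrite -hform_mul !KE.
rewrite hformBl !hformDr !hformNr !hformZl !hformZr.
rewrite rmorphM /= kk.
rewrite (hform_conj _ w v) //.
have -> : k * hform J z v * (k * hform J v w * hform J v v)
  = (k * hform J v v) * k * hform J v w * hform J z v by ring.
by ring: kv.
Qed.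

Section Siegel.
Context {C : numClosedFieldType} {n : nat}.
Hypothesis hn : (1 <= n)%N.
Local Notation sJ := (siegelJ C n).
Implicit Types (U K P : 'M[C]_n.+1) (z w x : 'cV[C]_n.+1).

Let ord0_max : (ord0 : 'I_n.+1) != ord_max.
Proof. by rewrite -val_eqE /= eq_sym -lt0n. Qed.

Let mid0 : mid (ord0 : 'I_n.+1) = false. Proof. by []. Qed.

Let midmax : mid (ord_max : 'I_n.+1) = false.
Proof. by rewrite /mid /= ltnn andbF. Qed.

Let midE (k : 'I_n.+1) : mid k = (k != ord0) && (k != ord_max).
Proof. by rewrite /mid -!val_eqE /= lt0n [(k < n)%N]ltn_neqAle -ltnS ltn_ord andbT. Qed.

Lemma mid_cases (k : 'I_n.+1) : [\/ k = ord0, k = ord_max | mid k].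
Proof.
have [->|k0] := eqVneq k ord0; first by constructor 1.
have [->|km] := eqVneq k ord_max; first by constructor 2.
by constructor 3; rewrite midE k0 km.
Qed.

Lemma sum_siegel (F : 'I_n.+1 -> C) :
  \sum_k F k = F ord0 + F ord_max + \sum_(k | mid k) F k.
Proof.
rewrite (bigD1 ord0) //= (bigD1 ord_max) /= 1?eq_sym // addrA.
by congr (_ + _); apply: eq_bigl => k; rewrite midE.
Qed.

Let swap (k : 'I_n.+1) :=
  if k == ord0 then ord_max else if k == ord_max then ord0 else k.

Lemma siegelJ_mul z k : (sJ *m z) k 0 = z (swap k) 0.
Proof.
have E j : sJ k j = (j == swap k)%:R.
  rewrite mxE /swap midE.
  case: (eqVneq k ord0) => [->|k0] /=.
    by rewrite (negPf ord0_max) andbF !orbF; case: (j == _).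
  case: (eqVneq k ord_max) => [->|km] /=; last by rewrite andbT eq_sym; case: eqP.
  by rewrite andbF orbF; case: (j == _).
rewrite mxE (bigD1 (swap k)) //= E eqxx mul1r big1 ?addr0 // => j /negPf jk.
by rewrite E jk mul0r.
Qed.

Lemma hform_siegel z w : hform sJ z w =
  z ord_max 0 * (w ord0 0)^* + z ord0 0 * (w ord_max 0)^*
  + \sum_(k | mid k) z k 0 * (w k 0)^*.
Proof.
rewrite /hform -mulmxA mxE sum_siegel !siegelJ_mul /swap eqxx [ord_max == _]eq_sym.
rewrite (negPf ord0_max) eqxx !mxE; congr (_ + _); first by rewrite !(mulrC (_^*)).
apply: eq_bigr => k mk; rewrite siegelJ_mul /swap !mxE mulrC.
by move: mk; rewrite midE => /andP[/negPf -> /negPf ->].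
Qed.

(* Carries the diagonal form to the Siegel form:
   e_0 -> e_0 + e_n / 2, e_n -> e_0 - e_n / 2. *)
Definition cayley : 'M[C]_n.+1 := \matrix_(i, j)
  (if i == ord0 then (if (j == ord0) || (j == ord_max) then 1 else 0)
   else if i == ord_max then
     (if j == ord0 then 2%:R^-1 else if j == ord_max then - 2%:R^-1 else 0)
   else (i == j)%:R).

Lemma cayley_mul z k : (cayley *m z) k 0 =
  if k == ord0 then z ord0 0 + z ord_max 0
  else if k == ord_max then (z ord0 0 - z ord_max 0) / 2%:R else z k 0.
Proof.
rewrite mxE sum_siegel !mxE !eqxx !(eq_sym ord_max) (negPf ord0_max) ?orbT /=.
case: (mid_cases k) => [->|->|mk].
- rewrite eqxx !mul1r big1 ?addr0 // => i.
  by rewrite mxE midE eqxx => /andP[/negPf -> /negPf ->]; rewrite mul0r.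
- rewrite (eq_sym ord_max) (negPf ord0_max) eqxx big1 ?addr0 => [|i].
    by rewrite mulrBl mulNr ![2%:R^-1 * _]mulrC.
  rewrite mxE midE (eq_sym ord_max) (negPf ord0_max) eqxx.
  by move=> /andP[/negPf -> /negPf ->]; rewrite mul0r.
have [k0 km] : k != ord0 /\ k != ord_max by apply/andP; rewrite -midE.
rewrite (negPf k0) (negPf km) !mul0r !add0r (bigD1 k) //= big1 => [|i /andP[mi ik]].
  by rewrite mxE eqxx (negPf k0) (negPf km) mul1r addr0.
by rewrite mxE (negPf k0) (negPf km) [k == i]eq_sym (negPf ik) mul0r.
Qed.

Lemma cayley_siegel : cayley ^t* *m sJ *m cayley = stdsig C n.
Proof.
apply: hform_inj => z w; rewrite -hform_mul hform_siegel hform_stdsig !cayley_mul.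
rewrite !eqxx [ord_max == _]eq_sym (negPf ord0_max).
rewrite [\sum_(k | k != _) _](bigD1 ord0) //=.
rewrite (eq_bigr (fun k => z k 0 * (w k 0)^*)) => [|k mk]; last first.
  by rewrite !cayley_mul; move: mk; rewrite midE => /andP[/negPf -> /negPf ->].
rewrite [in RHS](eq_bigl (@mid n)) => [|k]; last by rewrite midE andbC.
rewrite [RHS]addrAC; congr (_ + _).
rewrite !rmorphM !rmorphB !rmorphD fmorphV rmorph_nat.
by field.
Qed.

Lemma cayley_unit : cayley \in unitmx.
Proof.
by have := stdsig_unit C n; rewrite -cayley_siegel unitmx_mul => /andP[].
Qed.

Lemma siegelJ_conj : sJ ^t* = sJ.
Proof.
apply/matrixP=> i j; rewrite !mxE [j == i]eq_sym.
rewrite [X in X || _]orbC ![_ && (i == _)]andbC.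
case: (eqVneq i j) => [->|_]; case: ifP => _; rewrite ?conjC1 ?conjC0 //.
Qed.

Lemma siegelJ_sig : hermitian_sig sJ.
Proof.
split; first exact: siegelJ_conj.
exists (invmx cayley); rewrite unitmx_inv cayley_unit; split=> //.
rewrite -cayley_siegel !mulmxA -trmxC_mul mulmxV ?cayley_unit // trmx1 map_mx1.
by rewrite mul1mx -mulmxA mulmxV ?cayley_unit // mulmx1.
Qed.

Lemma e0_null : nullv sJ (e0 C n).
Proof.
split.
  by apply/eqP=> /colP/(_ ord0); rewrite !mxE eqxx => /eqP; rewrite oner_eq0.
rewrite hform_siegel !mxE [ord_max == _]eq_sym (negPf ord0_max) eqxx.
rewrite mul0r conjC0 mulr0 !add0r big1 // => k.
by rewrite !mxE midE => /andP[/negPf -> _]; rewrite mul0r.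
Qed.

Lemma hform_e0 z : hform sJ z (e0 C n) = z ord_max 0.
Proof.
rewrite hform_siegel !mxE [ord_max == _]eq_sym (negPf ord0_max) eqxx.
rewrite conjC0 conjC1 mulr1 mulr0 addr0 big1 ?addr0 // => k.
by rewrite !mxE midE => /andP[/negPf -> _]; rewrite conjC0 mulr0.
Qed.


(* The reflection in x - e, where e is the multiple of e0 with <x, e> real,
   carries x to e. *)
Lemma siegel_null_transitive x : nullv sJ x -> exists K,
  isU sJ K /\ exists c : C, c != 0 /\ K *m x = c *: e0 C n.
Proof.
move=> nx; have [L lorL] := hermitian_sig_lorentzian _ _ _ siegelJ_sig.
have [h0|h0] := eqVneq (hform sJ (e0 C n) x) 0.
  have [c xE] := null_orthogonal_proportional _ _ lorL _ _ e0_null nx h0.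
  exists 1%:M; split; first by rewrite /isU trmx1 map_mx1 mul1mx mulmx1.
  exists c; split; last by rewrite mul1mx.
  by have [xn0 _] := nx; apply: contraNneq xn0 => c0; rewrite xE c0 scale0r.
have hJ := siegelJ_conj.
pose c := hform sJ x (e0 C n); pose e := c *: e0 C n.
have cn0 : c != 0 by rewrite /c -hform_conj // conjC_eq0.
have xe : hform sJ x e = `|c| ^+ 2 by rewrite hformZr -/c mulrC normCK.
have ex : hform sJ e x = `|c| ^+ 2.
  by rewrite -(hform_conj _ x e) // xe rmorphXn /= conj_normC.
have ee : hform sJ e e = 0 by rewrite hformZl hformZr (e0_null).2 !mulr0.
(* Here <v,v> = -2|c|^2, so [k] is 2/<v,v>, and <x,v> = -|c|^2 makes the reflection subtract exactly
   [v] from [x]. *)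
pose v := x - e; pose k : C := - `|c| ^- 2.
have kk : k^* = k by apply/CrealP; rewrite rpredN rpredV rpredX // normr_real.
have xv : hform sJ x v = - `|c| ^+ 2.
  by rewrite /v hformDr hformNr nx.2 xe add0r.
have vv : hform sJ v v = - (2%:R * `|c| ^+ 2).
  rewrite {1}/v hformBl xv /v hformDr hformNr ex ee subr0.
  by rewrite mulr_natl mulr2n opprD.
have c2 : `|c| ^+ 2 != 0 by rewrite expf_eq0 normr_eq0 (negPf cn0).
have [K [uK KE]] : exists K, isU sJ K /\
    forall z, K *m z = z - (k * hform sJ z v) *: v.
  apply: reflection_isU => //.
  by rewrite vv /k mulrNN mulrCA mulVf // mulr1.
exists K; split=> //.
exists c; split=> //; rewrite KE xv /k mulNr mulrN opprK mulVf // scale1r.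
by rewrite /v opprB addrC subrK.
Qed.

(** [P] passes to the diagonal form and [cayley] to the Siegel form; the transitivity of the Siegel
    unitary group on null lines then moves the image of [x] to infinity. *)
Lemma siegel_frame (J : 'M[C]_n.+1) x : hermitian_sig J -> nullv J x ->
  exists K, [/\ K \in unitmx, K ^t* *m sJ *m K = J &
    exists c : C, c != 0 /\ K *m x = c *: e0 C n].
Proof.
move=> [hJ [P [Pu JE]]] [xn0 x0].
pose Q := cayley *m P.
have QJ : Q ^t* *m sJ *m Q = J.
  by rewrite JE -cayley_siegel /Q trmxC_mul !mulmxA.
have Qu : Q \in unitmx by rewrite unitmx_mul cayley_unit.
have nQx : nullv sJ (Q *m x).
  split; last by rewrite hform_mul QJ.
  by apply: contraNneq xn0 => Qx; rewrite -(mulKmx Qu x) Qx mulmx0.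
have [R [uR [c [cn0 Rx]]]] := siegel_null_transitive _ nQx.
exists (R *m Q); split.
- rewrite unitmx_mul Qu andbT; apply: isU_unit uR.
  exact: hermitian_sig_unit siegelJ_sig.
- by rewrite trmxC_mul -[RHS]QJ -[in RHS]uR !mulmxA.
by exists c; rewrite -mulmxA.
Qed.

(** Pairing with [e0] determines the last row. A middle basis vector moves only by a multiple of
    [e0], and pairing its image with the last column [u] gives that multiple; <u,u> = 0 fixes the
    real part of the corner entry. *)
Lemma siegel_unipotent_heis U : isU sJ U -> unipotent U ->
  U *m e0 C n = e0 C n ->
  exists tau t, t \is Num.real /\ U = heis tau t.
Proof.
move=> uU /unipotentP nU Ue0.
have [L lorL] := hermitian_sig_lorentzian _ _ _ siegelJ_sig.
have hJ := siegelJ_conj.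
have last_row z : (U *m z) ord_max 0 = z ord_max 0.
  by have := hform_isU _ _ z (e0 C n) uU; rewrite Ue0 !hform_e0.
pose e j : 'cV[C]_n.+1 := delta_mx j 0.
have UeE i j : U i j = (U *m e j) i 0 by rewrite -colE mxE.
have eE i j : e j i 0 = (i == j)%:R by rewrite mxE eqxx andbT.
pose u := U *m e ord_max.
have umax : u ord_max 0 = 1 by rewrite last_row eE eqxx.
have Umid j : mid j -> U *m e j = e j - (u j 0)^* *: e0 C n.
  move=> mj; have [j0 jm] : j != ord0 /\ j != ord_max by apply/andP; rewrite -midE.
  have ej : hform sJ (e j) (e0 C n) = 0.
    by rewrite hform_e0 eE eq_sym (negPf jm).
  have [c cE] := unipotent_null_orthogonal _ _ _ _ _ lorL uU nU e0_null Ue0 ej.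
  have UE : U *m e j = e j + c *: e0 C n.
    by rewrite -cE mulmxBl mul1mx addrC subrK.
  have := hform_isU _ _ (e j) (e ord_max) uU; rewrite -/u UE hformDl hformZl.
  have hej w : hform sJ (e j) w = (w j 0)^*.
    rewrite hform_siegel !eE ![_ == j]eq_sym (negPf j0) (negPf jm) !mul0r !add0r.
    rewrite (bigD1 j) //= eE eqxx mul1r big1 ?addr0 // => i /andP[_ /negPf ij].
    by rewrite eE ij mul0r.
  rewrite !hej eE (negPf jm) conjC0 -hform_conj // hform_e0 umax conjC1 mulr1.
  move/eqP; rewrite addrC addr_eq0 => /eqP cu.
  by rewrite cu scaleNr.
have uu : u ord0 0 + (u ord0 0)^* = - \sum_(k | mid k) u k 0 * (u k 0)^*.
  have := hform_isU _ _ (e ord_max) (e ord_max) uU; rewrite -/u.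
  rewrite !hform_siegel umax conjC1 mul1r mulr1 !eE (negPf ord0_max) !conjC0.
  rewrite mulr0 mul0r addr0 add0r [X in _ = X -> _]big1 => [|i]; last first.
    by rewrite midE eE => /andP[_ /negPf ->]; rewrite mul0r.
  by move/eqP; rewrite addr_eq0 [_^* + _]addrC => /eqP.
(* [heis] reads only the middle coordinates of [u]; the factor 2 compensates the halving in the
   corner entry. *)
exists u, ('Im (u ord0 0) *+ 2); split; first by rewrite rpredMn // Creal_Im.
apply/matrixP=> i j; rewrite UeE [RHS]mxE.
have u0E : u ord0 0 = (- (\sum_(k | mid k) u k 0 * (u k 0)^*) +
    'Im (u ord0 0) *+ 2 * 'i) / 2%:R.
  rewrite -uu [in X in _ = X / _]mulrnAl [_ * 'i]mulrC.
  have -> : (u ord0 0)^* = 'Re (u ord0 0) - 'i * 'Im (u ord0 0).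
    by rewrite {1}[u ord0 0]Crect rmorphD rmorphM /= conjCi !conj_Creal ?Creal_Re ?Creal_Im // mulNr.
  rewrite {1 2}[u ord0 0]Crect.
  by field.
case: (mid_cases j) => [->|->|mj].
- have -> : e ord0 = e0 C n by apply/colP=> k; rewrite eE mxE.
  rewrite Ue0 mxE mid0 [ord0 == ord_max](negPf ord0_max) !andbF.
  by case: eqP.
- rewrite -/u; case: (mid_cases i) => [->|->|mi].
  + rewrite (negPf ord0_max) !eqxx midmax andbF /=.
    exact: u0E.
  + by rewrite eqxx umax.
  rewrite mi eqxx /=; move: (mi); rewrite midE => /andP[/negPf i0 /negPf im].
  by rewrite i0 im.
rewrite Umid // !mxE eqxx andbT mj andbT.
move: (mj); rewrite midE => /andP[j0 jm].
rewrite (negPf jm) !andbF.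
have [->|ij] := eqVneq i j; first by rewrite (negPf j0) mulr0 subr0.
by rewrite sub0r; case: eqP => _; rewrite ?mulr1 // mulr0 oppr0.
Qed.

Lemma comm_heis (tau sigma : 'cV[C]_n.+1) (t s : C) :
  heis tau t *m heis sigma s = heis sigma s *m heis tau t ->
  'Im (\sum_(k | mid k) (tau k 0)^* * sigma k 0) = 0.
Proof.
have E (a b : 'cV[C]_n.+1) (p q : C) : (heis a p *m heis b q) ord0 ord_max =
    heis b q ord0 ord_max + heis a p ord0 ord_max
    - \sum_(k | mid k) (a k 0)^* * b k 0.
  rewrite mxE sum_siegel.
  have h1 (x : 'cV[C]_n.+1) r k : heis x r k k = 1 by rewrite mxE eqxx.
  rewrite !h1 mul1r mulr1 -sumrN; congr (_ + _); apply: eq_bigr => k mk.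
  move: (mk); rewrite midE => /andP[/negPf k0 /negPf km].
  by rewrite !mxE mk [ord0 == k]eq_sym k0 km !eqxx /= mulNr.
move=> /(congr1 (fun M : 'M_n.+1 => M ord0 ord_max)); rewrite !E.
rewrite [X in _ = X - _]addrC => /addrI/oppr_inj sE.
(* The two sums left by the comparison are conjugate to each other, so their equality makes the
   first one real. *)
apply/Creal_ImP; apply/CrealP; rewrite [RHS]sE rmorph_sum /=.
by apply: eq_bigr => k _; rewrite rmorphM /= conjCK mulrC.
Qed.

Lemma comm_unipotent_isotropic (J : 'M[C]_n.+1) x S T :
  hermitian_sig J -> nullv J x -> isU J S -> isU J T ->
  unipotent S -> unipotent T -> S *m x = x -> T *m x = x ->
  T *m S = S *m T -> isotropic J x S T.
Proof.
move=> sJ nx uS uT nS nT Sx Tx cTS.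
have [K [Ku KJ [c [cn0 Kx]]]] := siegel_frame _ _ sJ nx.
have H A : isU J A -> unipotent A -> A *m x = x ->
    exists tau t, t \is Num.real /\ K *m A *m invmx K = heis tau t.
  move=> uA /unipotentP nA Ax; apply: siegel_unipotent_heis.
  - rewrite /isU !trmxC_mul !mulmxA.
    have e : A ^t* *m K ^t* *m siegelJ C n *m K *m A = K ^t* *m siegelJ C n *m K.
      by rewrite KJ -[RHS]uA -[in RHS]KJ !mulmxA.
    have -> : invmx K ^t* *m A ^t* *m K ^t* *m siegelJ C n *m K *m A *m invmx K
      = invmx K ^t* *m (A ^t* *m K ^t* *m siegelJ C n *m K *m A) *m invmx K.
      by rewrite !mulmxA.
    rewrite e !mulmxA -trmxC_mul mulmxV // trmx1 map_mx1 mul1mx.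
    by rewrite -mulmxA mulmxV // mulmx1.
  - apply/unipotentP; have := nilpotent_mx_conj _ _ Ku nA.
    by rewrite mulmxBr mulmxBl mulmx1 mulmxV.
  have -> : e0 C n = c^-1 *: (K *m x) by rewrite Kx scalerA mulVf // scale1r.
  by rewrite -scalemxAr -!mulmxA (mulmxA (invmx K)) mulVmx // mul1mx Ax.
have [tau [t [tr tE]]] := H _ uT nT Tx.
have [sigma [s [sr sE]]] := H _ uS nS Sx.
exists K; split=> //; first by exists c.
exists tau, t, sigma, s; split=> //; apply: (comm_heis _ _ t s).
by rewrite -tE -sE !mulmxA !mulmxKV // -(mulmxA K T) cTS mulmxA.
Qed.

End Siegel.

(** * The complex line of a hyperbolic isometry *)

Section LineAction.
Context {C : numClosedFieldType} {m : nat} (J : 'M[C]_m).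
Implicit Types (S : 'M[C]_m) (z : 'cV[C]_m).

(** Built from 1x1 blocks so that products with [line_basis], itself a [row_mx], follow the block
    rules. *)
Definition diag2 (a b : C) : 'M[C]_2 := block_mx (a%:M : 'M_1) 0 0 b%:M.
Definition vec2 (a b : C) : 'cV[C]_2 := col_mx (a%:M : 'M_1) (b%:M : 'M_1).

Lemma vec2P (u : 'cV[C]_2) : exists a b, u = vec2 a b.
Proof.
exists ((usubmx (u : 'cV_(1 + 1))) 0 0), ((dsubmx (u : 'cV_(1 + 1))) 0 0).
by rewrite /vec2 -!mx11_scalar vsubmxK.
Qed.

Lemma vec2_inj a b c d : vec2 a b = vec2 c d -> a = c /\ b = d.
Proof.
move=> /(@eq_col_mx C 1 1 1) [/matrixP/(_ 0 0) + /matrixP/(_ 0 0)].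
by rewrite !mxE eqxx !mulr1n.
Qed.

Lemma scale_vec2 c a b : c *: vec2 a b = vec2 (c * a) (c * b).
Proof. by rewrite /vec2 (@scale_col_mx C 1 1 1) !scale_scalar_mx. Qed.

Lemma vec20 : vec2 0 0 = 0.
Proof. by rewrite /vec2 !raddf0 (@col_mx0 C 1 1 1). Qed.

Lemma diag2_mul p q a b : diag2 p q *m vec2 a b = vec2 (p * a) (q * b).
Proof.
by rewrite /diag2 /vec2 (@mul_block_col C 1 1 1 1 1) !mul0mx addr0 add0r -!scalar_mxM.
Qed.

Lemma line_basis_mul z1 z2 a b :
  line_basis z1 z2 *m vec2 a b = a *: z1 + b *: z2.
Proof. by rewrite /line_basis /vec2 (@mul_row_col C m 1 1 1) !mul_mx_scalar. Qed.

(** As [p] and [q] differ, every eigenvector lies on a coordinate axis; both axes are null for the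
    Gram form, which leaves no negative eigenvector and exactly two boundary points. *)
Lemma diag2_strictly_hyperbolic z1 z2 p q : nullv J z1 -> nullv J z2 ->
  p \is Num.real -> q \is Num.real -> p != q ->
  strictly_hyperbolic ((line_basis z1 z2) ^t* *m J *m line_basis z1 z2)
    (diag2 p q).
Proof.
move=> [_ z10] [_ z20] pr qr pq; set B := line_basis z1 z2; set G := _ *m B.
have GE u v : hform G u v = hform J (B *m u) (B *m v) by rewrite hform_mul.
have eig l a b : diag2 p q *m vec2 a b = l *: vec2 a b ->
    (a != 0 -> l = p) /\ (b != 0 -> l = q).
  rewrite diag2_mul scale_vec2 => /vec2_inj[pa qb].
  by split=> [a0|b0]; [apply/esym/(mulIf a0) | apply/esym/(mulIf b0)].
have axis l a b : diag2 p q *m vec2 a b = l *: vec2 a b -> a = 0 \/ b = 0.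
  move=> /eig[la lb]; have [->|a0] := eqVneq a 0; first by left.
  have [->|b0] := eqVneq b 0; first by right.
  by move: pq; rewrite -(la a0) -(lb b0) eqxx.
have null1 a : hform G (vec2 a 0) (vec2 a 0) = 0.
  by rewrite GE line_basis_mul scale0r addr0 hformZl hformZr z10 !mulr0.
have null2 b : hform G (vec2 0 b) (vec2 0 b) = 0.
  by rewrite GE line_basis_mul scale0r add0r hformZl hformZr z20 !mulr0.
have n10 : vec2 1 0 != 0.
  by apply/eqP; rewrite -vec20 => /vec2_inj[/eqP]; rewrite oner_eq0.
have n01 : vec2 0 1 != 0.
  by apply/eqP; rewrite -vec20 => /vec2_inj[_ /eqP]; rewrite oner_eq0.
split; last first.
  move=> l /eigenvalue_ofP[u]; have [a [b ->]] := vec2P u => un0 /eig[la lb].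
  have [a0|/la -> //] := eqVneq a 0; have [b0|/lb -> //] := eqVneq b 0.
  by move: un0; rewrite a0 b0 vec20 eqxx.
split.
  case=> u; have [a [b ->]] := vec2P u => -[nu [l /axis[u0|u0]]];
    by move: nu; rewrite u0 /negv ?null1 ?null2 ltxx.
exists (vec2 1 0), (vec2 0 1); split.
- by split=> //; exists p; rewrite diag2_mul scale_vec2 !mulr0.
- by split=> //; exists q; rewrite diag2_mul scale_vec2 !mulr0.
- case=> c; rewrite scale_vec2 mulr0 => /vec2_inj[_ /eqP].
  by rewrite oner_eq0.
move=> u; have [a [b ->]] := vec2P u => _ [l /axis[->|->]].
  by right; exists b; rewrite scale_vec2 mulr0 mulr1.
by left; exists a; rewrite scale_vec2 mulr0 mulr1.
Qed.

Lemma acts_on_line S z1 z2 a b : nullv J z1 -> nullv J z2 ->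
  S *m z1 = a *: z1 -> S *m z2 = b *: z2 -> a * b^* = 1 ->
  acts_id_or_strictly_hyperbolic_on_line J S z1 z2.
Proof.
move=> nz1 nz2 Sz1 Sz2 ab; exists (diag2 a b); split.
  rewrite /line_basis (_ : S *m _ = row_mx (S *m z1) (S *m z2)); last first.
    exact: mul_mx_row.
  rewrite Sz1 Sz2 /diag2 (@mul_row_block C m 1 1 1 1).
  by rewrite !mulmx0 addr0 add0r !mul_mx_scalar.
have [<-|nab] := eqVneq a b.
  by left; apply/is_scalar_mxP; exists a; rewrite /diag2 -scalar_mx_block.
have an0 : a != 0.
  by apply/negP=> /eqP a0; move/eqP: ab; rewrite a0 mul0r eq_sym oner_eq0.
(* This phase turns [a] into |a|, and since b is the inverse of the conjugate of [a], it turns [b]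
   into 1/|a|: both eigenvalues become real. *)
right; exists (`|a| / a); split.
  rewrite rmorphM /= fmorphV conj_normC mulf_div -normCK -expr2.
  by rewrite divff // expf_eq0 normr_eq0 (negPf an0).
have -> : (`|a| / a) *: diag2 a b = diag2 `|a| (`|a| / a * b).
  by rewrite /diag2 (@scale_block_mx C 1 1 1 1) !scale_scalar_mx !scaler0 divfK.
apply: diag2_strictly_hyperbolic => //; first exact: normr_real.
  have bE : b = (a^*)^-1.
    by rewrite -[b]conjCK -(mulKf an0 b^*) ab mulr1 fmorphV.
  by rewrite bE -mulrA -invfM -normCK rpredM ?rpredV ?rpredX ?normr_real.
apply: contraNneq nab => e; rewrite -(inj_eq (mulfI (_ : `|a| / a != 0))).
  by rewrite -e divfK.
by rewrite mulf_neq0 ?invr_eq0 ?normr_eq0.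
Qed.

End LineAction.

(** * Commutation with elliptic, hyperbolic and parabolic isometries *)

Section Commutation.
Context {C : numClosedFieldType} {n : nat} (J : 'M[C]_n.+1).
Hypothesis sigJ : hermitian_sig J.
Implicit Types (S T : 'M[C]_n.+1) (x : 'cV[C]_n.+1).

Let Ju : J \in unitmx. Proof. exact: hermitian_sig_unit. Qed.

Lemma elliptic_comm T S : isU J T -> isU J S -> elliptic J T ->
  (T *m S = S *m T <-> preserves_eigenspaces S T).
Proof.
move=> uT uS eT; have [L lorJ] := hermitian_sig_lorentzian _ _ _ sigJ.
apply: diagonalizable_comm_eigenspaces; first exact: isU_unit uS.
exact: elliptic_diagonalizable lorJ _ uT eT.
Qed.

Lemma hyperbolic_comm T S z1 z2 : isU J T -> isU J S -> hyperbolic J T ->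
  nullv J z1 -> fixes T z1 -> nullv J z2 -> fixes T z2 ->
  ~ proportional z1 z2 ->
  (T *m S = S *m T <-> preserves_eigenspaces S T /\
     acts_id_or_strictly_hyperbolic_on_line J S z1 z2).
Proof.
move=> uT uS [neT _] nz1 fz1 nz2 fz2 z12.
have [L lorJ] := hermitian_sig_lorentzian _ _ _ sigJ.
have Su : S \in unitmx by exact: isU_unit uS.
have dT : diagonalizable T.
  exact: two_null_fixed_diagonalizable lorJ _ _ _ uT nz1 nz2 z12 fz1 fz2.
split; last by case=> pST _; apply/diagonalizable_comm_eigenspaces.
move=> cTS; split; first exact: comm_preserves_eigenspaces.
have z21 : ~ proportional z2 z1.
  move=> [c z1E]; apply: z12; exists c^-1.
  have [z1n0 _] := nz1; have c0 : c != 0.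
    by apply: contraNneq z1n0 => c0; rewrite z1E c0 scale0r.
  by rewrite z1E scalerA mulVf // scale1r.
have [b Sz2] := hyperbolic_comm_fixes _ Ju _ lorJ _ _ _ _ uS uT neT
  nz1 nz2 z12 fz1 fz2 cTS.
have [a Sz1] := hyperbolic_comm_fixes _ Ju _ lorJ _ _ _ _ uS uT neT
  nz2 nz1 z21 fz2 fz1 cTS.
apply: (acts_on_line _ _ _ _ _ _ nz1 nz2 Sz1 Sz2).
exact: null_pair_eigenvalues lorJ _ _ _ _ _ uS nz1 nz2 z12 Sz1 Sz2.
Qed.

Lemma translation_comm T S x : (1 <= n)%N ->
  isU J T -> isU J S -> translation J T -> nullv J x -> fixes T x ->
  T *m S = S *m T ->
  [/\ boundary_elliptic J S, fixes S x & preserves T (fixpts J S)] \/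
  [/\ translation J S, fixes S x & isotropic J x S T] \/
  [/\ ellipto_parabolic J S, fixes S x & exists Ss Su,
      [/\ jordan_decomp J S Ss Su, preserves T (fixpts J Ss)
        & isotropic J x T Su]].
Proof.
move=> hn uT uS [pT unT] nx fx cTS.
have [L lorJ] := hermitian_sig_lorentzian _ _ _ sigJ.
have fSx := parabolic_comm_fixes _ Ju _ _ _ uS pT nx fx cTS.
have Tx := unipotent_fixes _ _ unT nx.1 fx.
have [eS|neS] := boolp.EM (elliptic J S).
  left; split=> //; last exact: comm_preserves_fixpts.
  exact: nonelliptic_comm_boundary lorJ _ _ uS uT pT.1 cTS eS.
have pS := parabolic_comm_parabolic _ Ju _ lorJ _ _ _ uS uT pT nx fx cTS neS.
right; have [unS|nunS] := boolp.EM (unipotent S); [left|right].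
  split=> //; apply: comm_unipotent_isotropic => //.
  exact: unipotent_fixes unS nx.1 fSx.
split=> //; have [Ss [Su jS]] := jordan_decomp_exists _ Ju _ uS.
have [cs cu] := jordan_decomp_comm _ Ju _ _ _ jS _ (esym cTS).
exists Ss, Su; split=> //; first exact: comm_preserves_fixpts.
have [[_ uSu] _ unSu _ _] := jS.
apply: comm_unipotent_isotropic => //.
exact: jordan_unipotent_fixes jS _ nx.1 fSx.
Qed.

Lemma ellipto_parabolic_comm T Ts Tu S x : (1 <= n)%N ->
  isU J T -> isU J S -> ellipto_parabolic J T -> jordan_decomp J T Ts Tu ->
  nullv J x -> fixes T x -> T *m S = S *m T ->
  [/\ boundary_elliptic J S, fixes S x, preserves Tu (fixpts J S)
    & preserves_eigenspaces Ts S] \/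
  [/\ translation J S, fixes S x, preserves S (fixpts J Ts)
    & isotropic J x S Tu] \/
  [/\ ellipto_parabolic J S, fixes S x & exists Ss Su,
      [/\ jordan_decomp J S Ss Su,
          preserves Tu (fixpts J Ss) /\ preserves Su (fixpts J Ts),
          isotropic J x Tu Su & preserves_eigenspaces Ts Ss]].
Proof.
move=> hn uT uS [pT _] jT nx fx cTS.
have [L lorJ] := hermitian_sig_lorentzian _ _ _ sigJ.
have fSx := parabolic_comm_fixes _ Ju _ _ _ uS pT nx fx cTS.
have Tux := jordan_unipotent_fixes _ Ju _ _ _ jT _ nx.1 fx.
have [cTs cTu] := jordan_decomp_comm _ Ju _ _ _ jT _ cTS.
have [[uTs uTu] _ unTu _ _] := jT.
have Tsu : Ts \in unitmx by exact: isU_unit uTs.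
have [eS|neS] := boolp.EM (elliptic J S).
  left; split=> //.
  - exact: nonelliptic_comm_boundary lorJ _ _ uS uT pT.1 cTS eS.
  - exact: comm_preserves_fixpts.
  exact: comm_preserves_eigenspaces.
have pS := parabolic_comm_parabolic _ Ju _ lorJ _ _ _ uS uT pT nx fx cTS neS.
right; have [unS|nunS] := boolp.EM (unipotent S); [left|right].
  split=> //; first exact: comm_preserves_fixpts.
  apply: comm_unipotent_isotropic => //.
  exact: unipotent_fixes unS nx.1 fSx.
split=> //; have [Ss [Su jS]] := jordan_decomp_exists _ Ju _ uS.
(* Decomposing [S] against [Ts] and then [Tu], each of which commutes with [S], makes every Jordan
   part of [S] commute with every Jordan part of [T]. *)
have [csTs cuTs] := jordan_decomp_comm _ Ju _ _ _ jS _ (esym cTs).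
have [csTu cuTu] := jordan_decomp_comm _ Ju _ _ _ jS _ (esym cTu).
have [[_ uSu] _ unSu _ _] := jS.
exists Ss, Su; split=> //.
- by split; apply: comm_preserves_fixpts.
- apply: comm_unipotent_isotropic => //.
  exact: jordan_unipotent_fixes jS _ nx.1 fSx.
exact: comm_preserves_eigenspaces.
Qed.

End Commutation.

Theorem theorem1p1 (R : realType) (n : nat) (hn : (1 <= n)%N)
    (J : 'M[R[i]]_n.+1) (hJ : hermitian_sig J) :
  (* (1) elliptic *)
  (forall T S : 'M[R[i]]_n.+1, isU J T -> isU J S -> elliptic J T ->
     (T *m S = S *m T <-> preserves_eigenspaces S T)) /\
  (* (2) hyperbolic; z1, z2 represent the two fixed points of T *)
  (forall (T S : 'M[R[i]]_n.+1) (z1 z2 : 'cV[R[i]]_n.+1),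
     isU J T -> isU J S -> hyperbolic J T ->
     nullv J z1 -> fixes T z1 -> nullv J z2 -> fixes T z2 ->
     ~ proportional z1 z2 ->
     (T *m S = S *m T <->
      preserves_eigenspaces S T /\
      acts_id_or_strictly_hyperbolic_on_line J S z1 z2)) /\
  (* (3) translation *)
  (forall (T S : 'M[R[i]]_n.+1) (x : 'cV[R[i]]_n.+1),
     isU J T -> isU J S -> translation J T ->
     nullv J x -> fixes T x -> T *m S = S *m T ->
     (([/\ boundary_elliptic J S, fixes S x & preserves T (fixpts J S)]) \/
        ([/\ translation J S, fixes S x & isotropic J x S T]) \/
        ([/\ ellipto_parabolic J S, fixes S x &
             exists Ss Su : 'M[R[i]]_n.+1,
               [/\ jordan_decomp J S Ss Su, preserves T (fixpts J Ss)
                 & isotropic J x T Su]]))) /\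
  (* (4) ellipto-parabolic *)
  (forall (T Ts Tu S : 'M[R[i]]_n.+1) (x : 'cV[R[i]]_n.+1),
     isU J T -> isU J S -> ellipto_parabolic J T -> jordan_decomp J T Ts Tu ->
     nullv J x -> fixes T x -> T *m S = S *m T ->
     (([/\ boundary_elliptic J S, fixes S x, preserves Tu (fixpts J S)
           & preserves_eigenspaces Ts S]) \/
        ([/\ translation J S, fixes S x, preserves S (fixpts J Ts)
           & isotropic J x S Tu]) \/
        ([/\ ellipto_parabolic J S, fixes S x &
             exists Ss Su : 'M[R[i]]_n.+1,
               [/\ jordan_decomp J S Ss Su,
                   preserves Tu (fixpts J Ss) /\ preserves Su (fixpts J Ts),
                   isotropic J x Tu Su & preserves_eigenspaces Ts Ss]]))).
Proof.
split; [|split; [|split]].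
- by move=> T S; exact: elliptic_comm.
- by move=> T S z1 z2; exact: hyperbolic_comm.
- by move=> T S x; exact: translation_comm.
by move=> T Ts Tu S x; exact: ellipto_parabolic_comm.
Qed.
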